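(* There are six $K$-orbits on planes $\pi$ in $\mathrm{PG}(5,q)$ which are disjoint from the Veronese surface $\mathcal{V}(\mathbb{F}_q)$, and meet the nucleus plane of $\mathcal{V}(\mathbb{F}_q)$ in a point: (a) one $K$-orbit of planes with point-orbit distributions $OD_0(\pi)=[0,1,0,q^2+q]$, (b) one $K$-orbit with $OD_0(\pi)=[0,1,3q,q^2-2q]$, (c) two $K$-orbits with $OD_0(\pi)=[0,1,q,q^2]$, and (d) two $K$-orbits with $OD_0(\pi)=[0,1,2q,q^2-q]$.
   Context: Let $q$ be even. The Veronese surface $\mathcal{V}(\mathbb{F}_q)\subset\mathrm{PG}(5,q)$ is the image of $(u_0,u_1,u_2)\mapsto(u_0^2,u_0u_1,u_0u_2,u_1^2,u_1u_2,u_2^2)$; a point $(y_0,\dots,y_5)$ is identified with the symmetric matrix $[y_0,y_1,y_2;\ y_1,y_3,y_4;\ y_2,y_4,y_5]$ and has the rank of this matrix. $K\cong\mathrm{PGL}(3,q)$ acts by $M\mapsto AMA^T$. The nucleus plane is $\pi_{\mathcal{N}}=\mathcal{Z}(Y_0,Y_3,Y_5)$. $OD_0(\pi)=[r_1,r_{2,n},r_{2,s},r_3]$ counts rank-1 points, points of $\pi\cap\pi_{\mathcal{N}}$, rank-2 points outside $\pi_{\mathcal{N}}$, and rank-3 points of $\pi$. *)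

(* Defs.v *)
From HB Require Import structures.
From mathcomp Require Import all_boot all_order all_fingroup all_algebra.

Set Implicit Arguments.
Unset Strict Implicit.
Unset Printing Implicit Defensive.

Import GRing.Theory.
Local Open Scope ring_scope.

(* Subspaces of PG(5,q) are the vector subspaces of 'rV[F]_6, with vector     *)
(* dimension: points are lines <[y]> and planes are 3-dimensional.            *)
Section FiniteSubspaces.
Variables (F : finFieldType) (vT : vectType F).

Import VectorInternalTheory.
HB.instance Definition _ := [Countable of {vspace vT} by <:].
HB.instance Definition _ := [Finite of {vspace vT} by <:].

End FiniteSubspaces.

(* Position (i, j) in the symmetric matrix of each coordinate y_0, ..., y_5.  *)
Definition coord_pos : 6.-tuple ('I_3 * 'I_3) :=
  [tuple (0, 0); (0, 1); (0, 2); (1, 1); (1, 2); (2, 2)].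

Definition sym_pos : 3.-tuple (3.-tuple 'I_6) :=
  [tuple [tuple 0; 1; 2]; [tuple 1; 3; 4]; [tuple 2; 4; 5]].

Section Veronese.
Variable F : finFieldType.
Implicit Types (y : 'rV[F]_6) (M A : 'M[F]_3) (U W : {vspace 'rV[F]_6}).

Definition sym_mx y : 'M[F]_3 :=
  \matrix_(i, j) y 0 (tnth (tnth sym_pos i) j).

Definition sym_coord M : 'rV[F]_6 :=
  \row_k M (tnth coord_pos k).1 (tnth coord_pos k).2.

Definition points U : {set {vspace 'rV[F]_6}} :=
  [set W | (\dim W == 1)%N && (W <= U)%VS].

(* vpick W is a representative of the point W; see point_rank_line. *)
Definition point_rank W : nat := \rank (sym_mx (vpick W)).

Definition veronese_map (u : 'rV[F]_3) : 'rV[F]_6 :=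
  \row_k (u 0 (tnth coord_pos k).1 * u 0 (tnth coord_pos k).2).

Definition veronese_surface : {set {vspace 'rV[F]_6}} :=
  [set <[veronese_map u]>%VS | u : 'rV[F]_3 & u != 0].

Definition hyperplane (k : 'I_6) : {vspace 'rV[F]_6} :=
  lker (linfun (fun y => col k y)).

Definition nucleus_plane : {vspace 'rV[F]_6} :=
  (hyperplane 0%R :&: hyperplane 3%R :&: hyperplane 5%R)%VS.

Definition OD0 U : seq nat :=
  [:: #|[set W in points U | point_rank W == 1%N]|;
      #|points (U :&: nucleus_plane)|;
      #|[set W in points U | (point_rank W == 2%N)
                             && ~~ (W <= nucleus_plane)%VS]|;
      #|[set W in points U | point_rank W == 3%N]|].

Definition congr_coord A y : 'rV[F]_6 := sym_coord (A *m sym_mx y *m A^T).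

Definition collineation A U : {vspace 'rV[F]_6} :=
  (linfun (congr_coord A) @: U)%VS.

Lemma sym_mx_is_linear : linear sym_mx.
Proof. by move=> a y z; apply/matrixP=> i j; rewrite !mxE. Qed.
HB.instance Definition _ :=
  GRing.isLinear.Build F 'rV[F]_6 'M[F]_3 _ sym_mx sym_mx_is_linear.

Lemma sym_coord_is_linear : linear sym_coord.
Proof. by move=> a M N; apply/rowP=> k; rewrite !mxE. Qed.
HB.instance Definition _ :=
  GRing.isLinear.Build F 'M[F]_3 'rV[F]_6 _ sym_coord sym_coord_is_linear.

Lemma congr_coord_is_linear A : linear (congr_coord A).
Proof.
move=> a y z; rewrite /congr_coord linearP mulmxDr -scalemxAr mulmxDl.
by rewrite -scalemxAl linearP.
Qed.
HB.instance Definition _ A :=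
  GRing.isLinear.Build F 'rV[F]_6 'rV[F]_6 _ (congr_coord A)
    (congr_coord_is_linear A).

Lemma sym_mxK : cancel sym_mx sym_coord.
Proof.
move=> y; apply/rowP=> k; rewrite !mxE; congr (y 0 _); apply/val_inj.
by case: k => [[|[|[|[|[|[|//]]]]]] ?].
Qed.

Lemma sym_mx_sym y : (sym_mx y)^T = sym_mx y.
Proof.
apply/matrixP=> i j; rewrite !mxE; congr (y 0 _); apply/val_inj.
by case: i => [[|[|[|//]]] ?]; case: j => [[|[|[|//]]] ?].
Qed.

Lemma sym_coordK M : M^T = M -> sym_mx (sym_coord M) = M.
Proof.
move=> Ms; have E i j : M i j = M j i by rewrite -{1}Ms mxE.
apply/matrixP=> i j; rewrite !mxE.
have [[-> ->]|[-> ->]] : let k := tnth coord_pos (tnth (tnth sym_pos i) j) in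
    k.1 = i /\ k.2 = j \/ k.1 = j /\ k.2 = i; last exact: E; last by [].
by case: i => [[|[|[|//]]] ?]; case: j => [[|[|[|//]]] ?];
   (by left; split; apply/val_inj) || (by right; split; apply/val_inj).
Qed.

Lemma congr_coordM A B y :
  congr_coord A (congr_coord B y) = congr_coord (A *m B) y.
Proof.
rewrite /congr_coord sym_coordK; last first.
  by rewrite !trmx_mul trmxK sym_mx_sym mulmxA.
by rewrite trmx_mul !mulmxA.
Qed.

Lemma congr_coord1 y : congr_coord 1%:M y = y.
Proof. by rewrite /congr_coord mul1mx trmx1 mulmx1 sym_mxK. Qed.

Lemma collineationM A B U :
  collineation A (collineation B U) = collineation (A *m B) U.
Proof.
rewrite /collineation -limg_comp; congr (_ @: _)%VS.
by apply/lfunP=> y; rewrite comp_lfunE !lfunE /= congr_coordM.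
Qed.

Lemma collineation1 U : collineation 1%:M U = U.
Proof.
rewrite /collineation -[RHS]lim1g; congr (_ @: _)%VS.
by apply/lfunP=> y; rewrite !lfunE /= congr_coord1.
Qed.

Lemma collineation_inj (A : {'GL_3[F]}) : injective (collineation (GLval A)).
Proof.
apply: (can_inj (g := collineation (invmx (GLval A)))) => U.
rewrite collineationM mulVmx ?collineation1 //.
exact: (valP A).
Qed.

Definition collineation_perm (A : {'GL_3[F]}) : {perm {vspace 'rV[F]_6}} :=
  perm (@collineation_inj A).

(* The group of projectivities induced by PGL(3,q), as permutations of the    *)
(* subspaces of PG(5,q): scalar matrices give the identity.                   *)
Definition K : {set {perm {vspace 'rV[F]_6}}} :=
  [set collineation_perm A | A : {'GL_3[F]}].

Lemma K_group_set : group_set K.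
Proof.
apply/group_setP; split.
  apply/imsetP; exists 1%g => //; apply/permP=> U.
  by rewrite perm1 permE; apply/esym/collineation1.
move=> _ _ /imsetP[A _ ->] /imsetP[B _ ->]; apply/imsetP; exists (B * A)%g => //.
by apply/permP=> U; rewrite permM !permE; apply: collineationM.
Qed.
Canonical K_group := Group K_group_set.

Lemma point_rank_line y : y != 0 -> point_rank <[y]>%VS = \rank (sym_mx y).
Proof.
move=> y0; rewrite /point_rank; have /vlineP[a Ea] := memv_pick <[y]>%VS.
have a0 : a != 0.
  apply: contraNneq y0 => a0; move: (vpick0 <[y]>%VS).
  by rewrite Ea a0 scale0r eqxx -dimv_eq0 dim_vline eqb0 negbK => <-.
by rewrite Ea linearZ /= eqmx_scale.
Qed.

Lemma memv_nucleus_plane y :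
  (y \in nucleus_plane) = [&& y 0 0 == 0, y 0 3 == 0 & y 0 5 == 0].
Proof.
have E k : (y \in hyperplane k) = (y 0 k == 0).
  rewrite memv_ker lfunE /=; apply/eqP/eqP=> [/colP/(_ 0)|y0].
    by rewrite !mxE.
  by apply/colP=> i; rewrite !mxE !ord1.
by rewrite !memv_cap !E andbA.
Qed.

End Veronese.

(* Main.v *)
(* Write a symmetric matrix as its diagonal together with an alternating part. *)

(* The six orbits are represented by the planes [rep]. [orbit_nplane_ex] moves an admissible plane
   into normal position, [nplane1_classification] and [nplane2_classification] reduce it to a
   representative, and [rep_orbit_inj] separates the representatives. The hardest case,
   [rootfree_orbit], rests on [cubic_moebius].

   By [OD0_singular], counting singular matrices suffices: the plane has no point of rank 1 and one
   nucleus point. For the first type of nucleus point, the determinant of the matrix with diagonal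
   (x^2, y^2, 0) is the square of v /\ C v^(2), so there are q points of rank 2 outside the nucleus
   plane for each zero of this cubic on the projective line. Two pairs of representatives share a
   distribution; [nplane_type_inv] and [nplane_pencil_inv] tell them apart. *)
(* In characteristic 2 the diagonal of A M A^T is the entrywise square of A    *)
(* applied to the diagonal of M, and squaring is bijective on F, so A can be   *)
(* chosen to kill the linear relation satisfied by the diagonals of the plane. *)
(* The plane then consists of all                                              *)
(*    [X, t, aX+bY; t, Y, cX+dY; ., ., 0]  or                                  *)
(*    [X, aX+bY, t; ., Y, cX+dY; t, ., 0],                                     *)
(* according to the nucleus point.  In the second case triangular matrices     *)
(* lead to three normal forms.  In the first one, C = [a, b; c, d] is          *)
(* invertible and defined up to C' P^(2) = P C with P in GL(2,q), P^(2) its    *)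
(* entrywise square.  If C v^(2) = v has a solution v != 0, there are two      *)
(* classes, by the index 2 of {n^2 + n} in F.  Otherwise C is determined up to *)
(* a scalar by the irreducible binary cubic v /\ C v^(2), and two irreducible  *)
(* cubics are equivalent: if x and y are roots of them in an extension, then   *)
(* 1, x, y, xy lie in the same cubic extension of F, hence are dependent, and  *)
(* this relation is a Moebius transformation from x to y.                      *)
(* The distribution OD0 follows from the number of singular matrices.          *)
Require Import Defs.
From mathcomp Require Import all_boot all_order all_fingroup all_algebra all_field.
From mathcomp Require Import ring zify.

Set Implicit Arguments.
Unset Strict Implicit.
Unset Printing Implicit Defensive.

Import GRing.Theory.
Local Open Scope ring_scope.

(** * Roots of irreducible cubics *)

Section CubicExtension.
Variables (F : finFieldType) (L : fieldExtType F).

(** The gcd of f and g has the root z, so it is not constant; as a divisor of the irreducible f it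
    has the size of f, too large to divide a nonzero g. *)
Lemma irreducible_root_small (f g : {poly F}) (z : L) :
  irreducible_poly f -> root (map_poly (in_alg L) f) z ->
  root (map_poly (in_alg L) g) z -> (size g < size f)%N -> g = 0.
Proof.
move=> [f1 irr_f] fz gz ltgf; apply/eqP; apply/negPn/negP => g0.
have /irr_f : gcdp f g %| f by apply: dvdp_gcdl.
have dz : root (gcdp (map_poly (in_alg L) f) (map_poly (in_alg L) g)) z.
  by rewrite root_gcd fz.
rewrite -gcdp_map in dz.
have d1 : size (gcdp f g) != 1%N.
  apply/negP => /size_poly1P[c c0 E]; move: dz.
  by rewrite E map_polyC /= rootC scaler_eq0 oner_eq0 orbF (negPf c0).
move=> /(_ d1) /eqp_size sz; move: ltgf.
by rewrite ltnNge -sz leq_gcdpr.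
Qed.

Lemma adjoin_dim_irreducible (f : {poly F}) (z : L) :
  irreducible_poly f -> root (map_poly (in_alg L) f) z ->
  \dim <<1; z>>%VS = (size f).-1.
Proof.
move=> irr_f fz; have f0 := irredp_neq0 irr_f.
have /polyOver1P[m Em] : minPoly 1 z \is a polyOver 1%VS by apply: minPolyOver.
rewrite dim_Fadjoin dimv1 muln1; apply: succn_inj; rewrite -size_minPoly.
rewrite prednK; last by rewrite size_poly_gt0.
apply/eqP; rewrite eqn_leq; apply/andP; split.
  rewrite -(size_map_poly (in_alg L) f) dvdp_leq ?map_poly_eq0 //.
  by apply: minPoly_dvdp fz; apply/polyOver1P; exists f.
rewrite leqNgt; apply/negP; rewrite Em size_map_poly => lt.
have m0 : m = 0.
  by apply: irreducible_root_small irr_f fz _ lt; rewrite -[map_poly _ m]Em root_minPoly.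
by move: (monic_neq0 (monic_minPoly 1 z)); rewrite Em m0 rmorph0 eqxx.
Qed.

(** Both adjoined fields have the same dimension n over F, and a subfield of dimension n is the
    fixed set of the power map of exponent #|F|^n, so they coincide. *)
Lemma adjoin_eq_irreducible (f g : {poly F}) (x y : L) :
  irreducible_poly f -> irreducible_poly g -> size f = size g ->
  root (map_poly (in_alg L) f) x -> root (map_poly (in_alg L) g) y ->
  y \in <<1; x>>%VS.
Proof.
move=> irr_f irr_g sz fx gy.
rewrite (Fermat's_little_theorem <<1; x>>%AS) /= (adjoin_dim_irreducible irr_f fx) sz.
by rewrite -(adjoin_dim_irreducible irr_g gy) -(Fermat's_little_theorem <<1; y>>%AS) memv_adjoin.
Qed.

Lemma root_Poly_in_alg (s : seq F) (z : L) :
  root (map_poly (in_alg L) (Poly s)) z = (horner_rec (map (in_alg L) s) z == 0).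
Proof. by rewrite map_Poly_id0 ?rmorph0 // /root horner_Poly. Qed.

Lemma cubic_root_indep (f : {poly F}) (x : L) (a b c : F) :
  irreducible_poly f -> size f = 4%N -> root (map_poly (in_alg L) f) x ->
  c%:A * x ^+ 2 + b%:A * x + a%:A = 0 -> [/\ a = 0, b = 0 & c = 0].
Proof.
move=> irr_f sz fx E.
have /polyP g0 : Poly [:: a; b; c] = 0.
  apply: irreducible_root_small irr_f fx _ _.
    by rewrite root_Poly_in_alg /= mul0r add0r mulrDl -mulrA -expr2 E.
  by rewrite sz ltnS size_Poly.
by have := (g0 0, g0 1, g0 2)%N; rewrite !coef_Poly !coef0 => -[[]].
Qed.

(** With determinant 0 the transformation is constant: y = p / r = q / s, cross-multiplied. *)
Lemma degenerate_moebius (p q r s x y : L) : p * s = q * r ->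
  r * x + s != 0 -> p * x + q = y * (r * x + s) -> y * s = q /\ y * r = p.
Proof.
move=> det0 m0 E; split; apply: (mulIf m0); rewrite mulrAC -E mulrDl.
  by rewrite mulrAC det0; ring.
by rewrite -det0; ring.
Qed.

(** The elements x, 1, y x, y lie in a space of dimension 3, so p x + q + r y x + s y = 0 for some
    coefficients, not all zero. Solving for y gives the transformation, with r and s negated. *)
Lemma cubic_moebius (f g : {poly F}) (x y : L) :
  irreducible_poly f -> irreducible_poly g -> size f = 4%N -> size g = 4%N ->
  root (map_poly (in_alg L) f) x -> root (map_poly (in_alg L) g) y ->
  exists p q r s : F, [/\ p * s - q * r != 0, r%:A * x + s%:A != 0
     & p%:A * x + q%:A = y * (r%:A * x + s%:A)].
Proof.
move=> irr_f irr_g szf szg fx gy.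
have yK : y \in <<1; x>>%VS.
  by apply: adjoin_eq_irreducible irr_f irr_g _ fx gy; rewrite szf szg.
have indep1 h z a b : irreducible_poly h -> size h = 4%N ->
    root (map_poly (in_alg L) h) z -> b%:A * z + a%:A = 0 -> a = 0 /\ b = 0.
  move=> irr_h szh hz E; case: (@cubic_root_indep h z a b 0 irr_h szh hz) => //.
  by rewrite scale0r mul0r add0r.
pose X : 4.-tuple L := [tuple x; 1; y * x; y].
have /existsP[k /andP[/eqP sk /existsP nk]] : [exists k : {ffun 'I_4 -> F},
    (\sum_(i < 4) k i *: X`_i == 0) && [exists i, k i != 0]].
  apply: contraT; rewrite negb_exists => /forallP indep.
  have fr : free X.
    apply/freeP=> k sk i; apply: contraTeq isT => ki.
    case/negP: (indep [ffun i => k i]); apply/andP; split.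
      by rewrite (eq_bigr (fun l => k l *: X`_l)) ?sk // => l _; rewrite ffunE.
    by apply/existsP; exists i; rewrite ffunE.
  have : (\dim <<X>> <= \dim <<1; x>>)%N.
    apply: dimvS; apply/span_subvP=> z; rewrite !inE => /or4P[]/eqP->;
      by rewrite ?memvM // ?memv_adjoin // ?rpred1 // mem1v.
  by rewrite (eqP fr) (adjoin_dim_irreducible irr_f fx) szf.
move: sk; rewrite !big_ord_recl big_ord0 /= addr0 => sk.
have : exists p q r s, p *: x + (q *: 1 + (r *: (y * x) + s *: y)) = 0 /\
   ~ [/\ p = 0, q = 0, r = 0 & s = 0].
  do 4!eexists; split; first exact: sk.
  case: nk => i /eqP nk [k0 k1 k2 k3]; apply: nk.
  by case: i => [[|[|[|[|//]]]] ?]; [rewrite -[RHS]k0|rewrite -[RHS]k1|rewrite -[RHS]k2|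
    rewrite -[RHS]k3]; congr (k _); exact/val_inj.
move=> [p [q [r [s [E n0]]]]]; exists p, q, (- r), (- s).
have Erel : p%:A * x + q%:A = y * ((- r)%:A * x + (- s)%:A).
  apply/eqP; rewrite -subr_eq0 -E !scaleNr -[r *: (y * x)]mulr_algl -[s *: y]mulr_algl.
  by rewrite -[p *: x]mulr_algl; apply/eqP; ring.
(* A zero denominator is a linear relation for x, so r = s = 0; then p x + q = 0 forces p = q =
   0. *)
have m0 : (- r)%:A * x + (- s)%:A != 0.
  apply: contra_notN n0 => /eqP m0; move: Erel; rewrite m0 mulr0.
  have [/eqP + /eqP] := indep1 f x _ _ irr_f szf fx m0.
  rewrite !oppr_eq0 => /eqP-> /eqP->.
  by move/(indep1 f x _ _ irr_f szf fx) => [-> ->].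
(* A zero determinant yields two linear relations for y, so all four coefficients vanish. *)
split=> //; apply: contra_notN n0; rewrite subr_eq0 => /eqP det0.
have dL : p%:A * (- s)%:A = q%:A * (- r)%:A :> L.
  by rewrite -!in_algE -!rmorphM det0.
have [yS yR] := degenerate_moebius dL m0 Erel.
have [|q0 s0] := indep1 g y (- q) (- s) irr_g szg gy.
  by rewrite mulrC yS -scalerDl subrr scale0r.
have [|p0 r0] := indep1 g y (- p) (- r) irr_g szg gy.
  by rewrite mulrC yR -scalerDl subrr scale0r.
by split; apply/eqP; rewrite -oppr_eq0; apply/eqP.
Qed.
End CubicExtension.

Lemma common_root_ext (F : finFieldType) (f g : {poly F}) :
  (1 < size f)%N -> (1 < size g)%N ->
  exists (L : fieldExtType F) (x y : L),
    root (map_poly (in_alg L) f) x /\ root (map_poly (in_alg L) g) y.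
Proof.
move=> f1 g1.
have fg0 : f * g != 0.
  by rewrite mulf_neq0 -?size_poly_gt0 ?(leq_trans _ f1) ?(leq_trans _ g1).
have [L [rs Ers _]] := FinSplittingFieldFor fg0; exists L.
have ex_root (h : {poly F}) : (1 < size h)%N -> h %| f * g ->
    exists x, root (map_poly (in_alg L) h) x.
  move=> h1; rewrite -(dvdp_map (in_alg L)) (eqp_dvdr _ Ers) => /dvdp_prod_XsubC[m Em].
  move: h1; rewrite -(size_map_poly (in_alg L)) (eqp_size Em) size_prod_XsubC.
  by case: (mask m rs) Em => // x s Em _; exists x;
    rewrite (eqp_root Em) root_prod_XsubC mem_head.
have [x fx] := ex_root f f1 (dvdp_mulr g (dvdpp f)).
have [y gy] := ex_root g g1 (dvdp_mull f (dvdpp g)).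
by exists x, y.
Qed.

(** The form X (c X^2 + d Y^2) + Y (a X^2 + b Y^2) vanishes at (y, 1), hence at (p x + q, r x + s).
    Squaring is additive, so the expansion in x has the same shape; its coefficients are the entries
    of adj(P) C P^(2). *)
Lemma cubic_form_moebius (R : comRingType) (p q r s a b c d x y : R) :
  2%:R = 0 :> R -> p * x + q = y * (r * x + s) ->
  c * y ^+ 3 + a * y ^+ 2 + d * y + b = 0 ->
  (r * (a * p ^+ 2 + b * r ^+ 2) + p * (c * p ^+ 2 + d * r ^+ 2)) * x ^+ 3 +
  (s * (a * p ^+ 2 + b * r ^+ 2) + q * (c * p ^+ 2 + d * r ^+ 2)) * x ^+ 2 +
  (r * (a * q ^+ 2 + b * s ^+ 2) + p * (c * q ^+ 2 + d * s ^+ 2)) * x +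
  (s * (a * q ^+ 2 + b * s ^+ 2) + q * (c * q ^+ 2 + d * s ^+ 2)) = 0.
Proof.
move=> two0 E /(congr1 (fun z => (r * x + s) ^+ 3 * z)); rewrite mulr0 => <-.
rewrite [RHS](_ : _ = c * (y * (r * x + s)) ^+ 3 + a * (y * (r * x + s)) ^+ 2 * (r * x + s)
  + d * (y * (r * x + s)) * (r * x + s) ^+ 2 + b * (r * x + s) ^+ 3); last by ring.
rewrite -E; set X := p * x + q; set Y := r * x + s.
rewrite [RHS](_ : _ = X * (c * (X ^+ 2) + d * Y ^+ 2) + Y * (a * X ^+ 2 + b * Y ^+ 2));
  last by ring.
have -> : X ^+ 2 = p ^+ 2 * x ^+ 2 + q ^+ 2 by rewrite /X; ring: two0.
have -> : Y ^+ 2 = r ^+ 2 * x ^+ 2 + s ^+ 2 by rewrite /Y; ring: two0.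
by rewrite /X /Y; ring.
Qed.

Lemma eliminate_cube (R : comRingType) (a b c d a' b' c' d' x : R) :
  2%:R = 0 :> R ->
  c * x ^+ 3 + a * x ^+ 2 + d * x + b = 0 ->
  c' * x ^+ 3 + a' * x ^+ 2 + d' * x + b' = 0 ->
  (c * a' + c' * a) * x ^+ 2 + (c * d' + c' * d) * x + (c * b' + c' * b) = 0.
Proof.
move=> two0 E E'; rewrite [LHS](_ : _ = c * (c' * x ^+ 3 + a' * x ^+ 2 + d' * x + b')
  + c' * (c * x ^+ 3 + a * x ^+ 2 + d * x + b)); last by ring: two0.
by rewrite E E' !mulr0 addr0.
Qed.

Lemma card_set_pred0 (T : finType) (P : pred T) :
  (forall t, P t = false) -> #|[set t | P t]| = 0%N.
Proof.
by move=> H; apply/eqP; rewrite cards_eq0; apply/eqP/setP=> t; rewrite !inE H.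
Qed.

Lemma collision_missed_value (T : finType) (f : T -> T) x y :
  f x = f y -> x != y -> exists b, forall n, f n != b.
Proof.
move=> fxy xy; have [/forallP onto|] := boolP [forall b, b \in codom f].
  have : #|codom f| == #|T| by rewrite (eq_card (B := T)).
  by move/image_injP/(_ x y isT isT fxy)/eqP; rewrite (negPf xy).
rewrite negb_forall => /existsP[b bf]; exists b => n.
by apply: contraNneq bf => <-; apply: codom_f.
Qed.

Section EvenField.
Variables (F : finFieldType) (two0 : 2%:R = 0 :> F).
Implicit Types (x y b : F) (v w : 'rV[F]_6) (U V W : {vspace 'rV[F]_6}) (A : 'M[F]_3).

Lemma opp2 x : - x = x.
Proof. by apply/esym/subr0_eq; rewrite opprK; ring: two0. Qed.

Let e3 : 3%:R = 1 :> F.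
Proof. by rewrite (_ : 3%:R = 1 + 2%:R); [rewrite two0 addr0 | ring]. Qed.
Let e4 : 4%:R = 0 :> F.
Proof. by rewrite (_ : 4%:R = 2%:R * 2%:R); [rewrite two0 mul0r | ring]. Qed.
Let e5 : 5%:R = 1 :> F.
Proof. by rewrite (_ : 5%:R = 1 + 4%:R); [rewrite e4 addr0 | ring]. Qed.
Let e6 : 6%:R = 0 :> F.
Proof. by rewrite (_ : 6%:R = 2%:R * 3%:R); [rewrite two0 mul0r | ring]. Qed.

(* The hypotheses given to ring only rewrite coefficients equal to their       *)
(* left-hand side, hence the list of small numerals.                           *)
Ltac ring2 := rewrite ?opp2; ring: two0 e3 e4 e5 e6.

(** * Squares and n^2 + n in characteristic 2 *)

Lemma sqr_inj : injective (fun x : F => x ^+ 2).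
Proof.
move=> x y /= /eqP; rewrite -subr_eq0.
have ->: x ^+ 2 - y ^+ 2 = (x - y) ^+ 2 by ring2.
by rewrite expf_eq0 /= subr_eq0 => /eqP.
Qed.

Lemma sqr_surj x : exists r, r ^+ 2 = x.
Proof. by have [g _ gK] := injF_bij sqr_inj; exists (g x). Qed.

(** The polynomial t^2 + t + x splits over F exactly for these x. *)
Definition artin_schreier x : bool := x \in codom (fun n : F => n ^+ 2 + n).

Lemma artin_schreierP x :
  reflect (exists n, n ^+ 2 + n = x) (artin_schreier x).
Proof.
by apply: (iffP codomP) => [[n ->]|[n <-]]; exists n.
Qed.

Lemma artin_schreierD x y :
  artin_schreier x -> artin_schreier y -> artin_schreier (x + y).
Proof.
move=> /artin_schreierP[m <-] /artin_schreierP[n <-].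
by apply/artin_schreierP; exists (m + n); ring2.
Qed.

Lemma artin_schreier_sqr x : artin_schreier (x ^+ 2) = artin_schreier x.
Proof.
apply/artin_schreierP/artin_schreierP=> [[n En]|[n <-]]; last first.
  by exists (n ^+ 2); ring2.
have [m Em] := sqr_surj n; exists m; apply: sqr_inj.
by rewrite -En -Em; ring2.
Qed.

Lemma nonsplit_quadratic_ex : exists b, ~~ artin_schreier b.
Proof.
have [||b Hb] := @collision_missed_value F (fun n => n ^+ 2 + n) 0 1.
- by ring2.
- by rewrite eq_sym oner_neq0.
by exists b; apply/artin_schreierP => -[n /eqP]; rewrite (negPf (Hb n)).
Qed.

Lemma nonsplit_cubic_ex : exists c, forall n : F, n ^+ 3 + n != c.
Proof.
apply: (@collision_missed_value F _ 0 1); first by ring2.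
by rewrite eq_sym oner_neq0.
Qed.

(** The fibres of n^2 + n are the pairs {n, n + 1}. *)
Lemma card_artin_schreier : (2 * #|artin_schreier| = #|F|)%N.
Proof.
have two n m : n ^+ 2 + n = m ^+ 2 + m :> F -> m = n \/ m = n + 1.
  move=> E; have /eqP : (m + n) * (m + n + 1) = 0.
    by rewrite (_ : _ * _ = m ^+ 2 + m + (n ^+ 2 + n)); [rewrite E|]; ring2.
  rewrite mulf_eq0 => /orP[]/eqP H; [left|right].
    by rewrite -[m]opp2; apply/esym/eqP; rewrite -addr_eq0 addrC H.
  by rewrite -[m]opp2; apply/esym/eqP; rewrite -addr_eq0 addrC addrA H.
rewrite -[RHS]sum1_card (partition_big (fun n : F => n ^+ 2 + n) artin_schreier) /=; last first.
  by move=> n _; apply/artin_schreierP; exists n.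
rewrite mulnC -sum_nat_const; apply: eq_bigr => x /artin_schreierP[n <-].
rewrite (eq_bigl (mem [set n; n + 1])) => [|m].
  by rewrite sum1_card cards2 -subr_eq0 opprD addNKr oppr_eq0 oner_neq0.
rewrite !inE; apply/eqP/orP => [E|[]/eqP->] //; last by ring2.
by case: (two n m) => // ->; [left|right].
Qed.

(** The translate by x of this subgroup lies in the complement and has the same size, so it is the
    complement. *)
Lemma artin_schreier_index2 x y :
  ~~ artin_schreier x -> ~~ artin_schreier y -> artin_schreier (x + y).
Proof.
move=> nx ny.
pose nA := [set z | ~~ artin_schreier z].
have sub : [set x + t | t in artin_schreier] \subset nA.
  apply/subsetP=> _ /imsetP[t Ht ->]; rewrite inE; apply: contra nx => H.
  by rewrite (_ : x = (x + t) + t); [exact: artin_schreierD|ring2].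
have /eqP E : [set x + t | t in artin_schreier] == nA.
  rewrite eqEcard sub card_imset; last exact: addrI.
  have := cardC artin_schreier; rewrite -card_artin_schreier.
  rewrite (_ : #|[predC artin_schreier]| = #|nA|).
    by rewrite mul2n -addnn => /addnI ->; rewrite leqnn.
  by rewrite cardsE.
have : y \in nA by rewrite inE.
rewrite -E => /imsetP[t Ht ->].
by rewrite (_ : _ + _ = t) //; ring2.
Qed.

(** * Explicit matrices and coordinates *)

Definition row6 (a b c d e f : F) : 'rV[F]_6 :=
  \row_k nth 0 [:: a; b; c; d; e; f] k.

Definition mx3 (a b c d e f g h i : F) : 'M[F]_3 :=
  \matrix_(r, s) nth 0 (nth [::] [:: [:: a; b; c]; [:: d; e; f]; [:: g; h; i]] r) s.

Ltac case3 i := case: i => [[|[|[|//]]] ?].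
Ltac case6 i := case: i => [[|[|[|[|[|[|//]]]]]] ?].

Lemma row6E (a b c d e f : F) (y := row6 a b c d e f) :
  ((y 0 0 = a) * (y 0 1 = b) * (y 0 2 = c)) *
  ((y 0 3 = d) * (y 0 4 = e) * (y 0 5 = f)).
Proof. by rewrite /y !mxE. Qed.

Lemma row6_eta (y : 'rV[F]_6) :
  y = row6 (y 0 0) (y 0 1) (y 0 2) (y 0 3) (y 0 4) (y 0 5).
Proof.
by apply/rowP=> k; rewrite mxE; case6 k => /=; congr (y 0 _); apply/val_inj.
Qed.

Lemma mx3_eta (A : 'M[F]_3) :
  A = mx3 (A 0 0) (A 0 1) (A 0 2) (A 1 0) (A 1 1) (A 1 2)
          (A 2 0) (A 2 1) (A 2 2).
Proof.
apply/matrixP=> r s; rewrite mxE; case3 r; case3 s => /=;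
by congr (A _ _); apply/val_inj.
Qed.

Lemma mulmx3 (a b c d e f g h i a' b' c' d' e' f' g' h' i' : F) :
  mx3 a b c d e f g h i *m mx3 a' b' c' d' e' f' g' h' i' =
  mx3 (a * a' + b * d' + c * g') (a * b' + b * e' + c * h')
      (a * c' + b * f' + c * i')
      (d * a' + e * d' + f * g') (d * b' + e * e' + f * h')
      (d * c' + e * f' + f * i')
      (g * a' + h * d' + i * g') (g * b' + h * e' + i * h')
      (g * c' + h * f' + i * i').
Proof.
apply/matrixP=> r s; rewrite !mxE !big_ord_recl big_ord0 !mxE.
by case3 r; case3 s => /=; ring.
Qed.

Lemma trmx3 (a b c d e f g h i : F) :
  (mx3 a b c d e f g h i)^T = mx3 a d g b e h c f i.
Proof. by apply/matrixP=> r s; rewrite !mxE; case3 r; case3 s. Qed.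

Lemma sym_row6 (a b c d e f : F) :
  sym_mx (row6 a b c d e f) = mx3 a b c b d e c e f.
Proof. by apply/matrixP=> r s; rewrite !mxE; case3 r; case3 s. Qed.

Lemma sym_coord_mx3 (a b c d e f g h i : F) :
  sym_coord (mx3 a b c d e f g h i) = row6 a b c e f i.
Proof. by apply/rowP=> k; rewrite !mxE; case6 k. Qed.

Lemma congr_row6 (a b c d e f g h i y0 y1 y2 y3 y4 y5 : F) :
  congr_coord (mx3 a b c d e f g h i) (row6 y0 y1 y2 y3 y4 y5) =
  row6 (a ^+ 2 * y0 + b ^+ 2 * y3 + c ^+ 2 * y5)
       (a * (d * y0 + e * y1 + f * y2) + b * (d * y1 + e * y3 + f * y4)
        + c * (d * y2 + e * y4 + f * y5))
       (a * (g * y0 + h * y1 + i * y2) + b * (g * y1 + h * y3 + i * y4)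
        + c * (g * y2 + h * y4 + i * y5))
       (d ^+ 2 * y0 + e ^+ 2 * y3 + f ^+ 2 * y5)
       (d * (g * y0 + h * y1 + i * y2) + e * (g * y1 + h * y3 + i * y4)
        + f * (g * y2 + h * y4 + i * y5))
       (g ^+ 2 * y0 + h ^+ 2 * y3 + i ^+ 2 * y5).
Proof.
rewrite /congr_coord sym_row6 trmx3 !mulmx3 sym_coord_mx3.
by congr row6; ring2.
Qed.

Lemma det_mx3 (a b c d e f g h i : F) :
  \det (mx3 a b c d e f g h i) =
  a * (e * i + f * h) + b * (d * i + f * g) + c * (d * h + e * g).
Proof.
rewrite (expand_det_row _ ord0) !big_ord_recl big_ord0 /cofactor.
rewrite !(expand_det_row _ ord0) !big_ord_recl !big_ord0 /cofactor !det_mx11.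
by rewrite !mxE /=; ring2.
Qed.

Lemma det_sym_row6 (a b c d e f : F) :
  \det (sym_mx (row6 a b c d e f)) =
  a * d * f + a * e ^+ 2 + d * c ^+ 2 + f * b ^+ 2.
Proof. by rewrite sym_row6 det_mx3; ring2. Qed.

Lemma veronese_row3 (u : 'rV[F]_3) :
  veronese_map u =
  row6 (u 0 0 ^+ 2) (u 0 0 * u 0 1) (u 0 0 * u 0 2)
       (u 0 1 ^+ 2) (u 0 1 * u 0 2) (u 0 2 ^+ 2).
Proof.
by apply/rowP=> k; rewrite !mxE; case6 k; rewrite /= ?expr2.
Qed.

(** * Collineations and point-orbit distributions *)

Lemma collineation_dim A U : A \in unitmx -> \dim (collineation A U) = \dim U.
Proof.
move=> uA; apply: limg_dim_eq; apply/eqP; rewrite -subv0 -(capv0 U) capvS //.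
apply/subvP=> v; rewrite memv_ker lfunE /= memv0 => /eqP E.
by rewrite -(congr_coord1 v) -(mulVmx uA) -congr_coordM E linear0.
Qed.

Lemma mem_collineation A U v : A \in unitmx ->
  (v \in collineation A U) = (congr_coord (invmx A) v \in U).
Proof.
move=> uA; apply/memv_imgP/idP => [[w Hw ->]|Hv].
  by rewrite lfunE /= congr_coordM mulVmx // congr_coord1.
exists (congr_coord (invmx A) v) => //.
by rewrite lfunE /= congr_coordM mulmxV // congr_coord1.
Qed.

Lemma collineation_eq A U V : A \in unitmx -> \dim U = \dim V ->
  (forall v, v \in U -> congr_coord A v \in V) -> collineation A U = V.
Proof.
move=> uA dUV UV; apply/eqP; rewrite eqEdim collineation_dim // dUV leqnn andbT.
by apply/subvP=> _ /memv_imgP[v Hv ->]; rewrite lfunE /=; apply: UV.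
Qed.

Lemma mem_orbitK U V :
  reflect (exists2 A, A \in unitmx & collineation A U = V)
          (V \in orbit 'P (K F) U).
Proof.
apply: (iffP imsetP) => [[_ /imsetP[A _ ->] ->]|[A uA <-]].
  by exists (GLval A); [exact: (valP A)|rewrite /= apermE permE].
exists (collineation_perm (FinRing.unit 'M_3 uA : {'GL_3[F]})).
  exact: imset_f.
by rewrite /= apermE permE.
Qed.

Lemma orbitK_collineation A U :
  A \in unitmx -> collineation A U \in orbit 'P (K F) U.
Proof. by move=> uA; apply/mem_orbitK; exists A. Qed.

Lemma veronese_map_eq0 (u : 'rV[F]_3) : (veronese_map u == 0) = (u == 0).
Proof.
apply/eqP/eqP=> [E|->]; last by apply/rowP=> k; rewrite !mxE mul0r.
have H i : u 0 i ^+ 2 = 0.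
  have [k Ek] : exists k, tnth coord_pos k = (i, i).
    case3 i; [exists 0|exists 3|exists 5]; congr pair; exact/val_inj.
  by move/rowP/(_ k): E; rewrite !mxE Ek.
by apply/rowP=> i; apply/eqP; rewrite mxE -sqrf_eq0 H.
Qed.

Lemma sym_mx_veronese (u : 'rV[F]_3) : sym_mx (veronese_map u) = u^T *m u.
Proof.
apply/matrixP=> i j; rewrite !mxE big_ord1 !mxE.
have [E|E] : tnth coord_pos (tnth (tnth sym_pos i) j) = (i, j) \/
             tnth coord_pos (tnth (tnth sym_pos i) j) = (j, i).
- by case3 i; case3 j; (left; congr pair; exact/val_inj)
     || (right; congr pair; exact/val_inj).
- by rewrite E.
- by rewrite E mulrC.
Qed.

Lemma congr_coord_veronese A (u : 'rV[F]_3) :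
  congr_coord A (veronese_map u) = veronese_map (u *m A^T).
Proof.
rewrite -[RHS]sym_mxK sym_mx_veronese trmx_mul trmxK /congr_coord.
by rewrite sym_mx_veronese !mulmxA.
Qed.

(** In characteristic 2 the nucleus plane consists of the alternating matrices, which congruences
    preserve. *)
Lemma congr_coord_nucleus A v :
  v \in nucleus_plane F -> congr_coord A v \in nucleus_plane F.
Proof.
rewrite !memv_nucleus_plane (mx3_eta A) [v in congr_coord _ v]row6_eta congr_row6.
rewrite !row6E => /and3P[/eqP-> /eqP-> /eqP->].
by rewrite !mulr0 !addr0 eqxx.
Qed.

Lemma disjoint_veroneseP U :
  reflect (forall u : 'rV[F]_3, u != 0 -> veronese_map u \notin U)
          [disjoint points U & veronese_surface F].
Proof.
rewrite disjoint_sym; apply: (iffP pred0P) => [H u u0|H W].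
  apply/negP => Hu; have /= := H <[veronese_map u]>%VS.
  have -> : <[veronese_map u]>%VS \in veronese_surface F.
    by apply/imsetP; exists u; rewrite ?inE.
  by rewrite inE dim_vline veronese_map_eq0 u0 -memvE Hu.
rewrite /= ; apply/negP=> /andP[/imsetP[u]]; rewrite inE => u0 ->.
by rewrite inE -memvE => /andP[_]; apply/negP/H.
Qed.

Definition admissible_plane U : bool :=
  [&& (\dim U == 3)%N, [disjoint points U & veronese_surface F]
    & (\dim (U :&: nucleus_plane F) == 1)%N].

Lemma admissible_plane_collineation A U : A \in unitmx ->
  admissible_plane U -> admissible_plane (collineation A U).
Proof.
move=> uA /and3P[dU /disjoint_veroneseP UV dUN]; apply/and3P; split.
- by rewrite collineation_dim.
- apply/disjoint_veroneseP => u u0; rewrite mem_collineation //.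
  rewrite congr_coord_veronese; apply: UV; apply: contraNneq u0 => E.
  by rewrite -(mulmxK (_ : (invmx A)^T \in unitmx) u) ?E ?mul0mx // unitmx_tr unitmx_inv.
rewrite (_ : _ :&: _ = collineation A (U :&: nucleus_plane F))%VS.
  by rewrite collineation_dim.
apply/vspaceP => v; rewrite [LHS]memv_cap !mem_collineation // [RHS]memv_cap; congr (_ && _).
apply/idP/idP => [/(congr_coord_nucleus (invmx A)) //|].
by move/(congr_coord_nucleus A); rewrite congr_coordM mulmxV // congr_coord1.
Qed.

(** Congruence by A multiplies determinants by the nonzero square of det A. *)
Lemma singular_collineation A U : A \in unitmx ->
  #|[set v in collineation A U | \det (sym_mx v) == 0]| =
  #|[set v in U | \det (sym_mx v) == 0]|.
Proof.
move=> uA.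
have inj : injective (congr_coord A).
  by apply: (can_inj (g := congr_coord (invmx A))) => v;
    rewrite congr_coordM mulVmx // congr_coord1.
rewrite -[RHS](card_imset _ inj); apply: eq_card => v.
have E : v = congr_coord A (congr_coord (invmx A) v).
  by rewrite congr_coordM mulmxV // congr_coord1.
rewrite [in RHS]E mem_imset // !inE mem_collineation //; congr (_ && _).
rewrite [in LHS]E /congr_coord sym_coordK ?trmx_mul ?trmxK ?sym_mx_sym ?mulmxA //.
rewrite !det_mulmx det_tr mulf_eq0 mulf_eq0 orbC.
by rewrite unitmxE unitfE in uA; rewrite (negPf uA).
Qed.

(** Each point contains #|F| - 1 nonzero vectors. *)
Lemma card_points U (P : pred {vspace 'rV[F]_6}) :
  #|[set v in U | (v != 0) && P <[v]>%VS]| = (#|[set W in points U | P W]| * #|F|.-1)%N.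
Proof.
rewrite -sum1_card -sum_nat_const.
rewrite (partition_big (fun v => <[v]>%VS) (mem [set W in points U | P W])) /=; last first.
  by move=> v; rewrite !inE dim_vline -memvE => /and3P[-> -> ->].
apply: eq_bigr => W; rewrite !inE => /andP[/andP[/eqP dW WU] PW].
rewrite (eq_bigl (mem [set v in W | v != 0])) => [|v].
  rewrite sum1_card (_ : [set v in W | v != 0] = [set v in W] :\ 0).
    have := cardsD1 0 [set v in W]; rewrite inE mem0v cardsE card_vspace dW expn1.
    by move=> ->.
  by apply/setP=> v; rewrite !inE andbC.
rewrite !inE; apply/andP/andP => [[/and3P[vU v0 _] /eqP <-]|[vW v0]].
  by rewrite memv_line.
have E : <[v]>%VS = W by apply/eqP; rewrite eqEdim -memvE vW dim_vline v0 dW.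
by rewrite E eqxx v0 PW (subvP WU).
Qed.

(** Take for u the square roots of the diagonal. Rank 1 gives M_ij^2 = M_ii M_jj, and square roots
    are unique, so u_i u_j = M_ij. *)
Lemma rank1_veronese v :
  \rank (sym_mx v) = 1%N -> exists2 u, u != 0 & veronese_map u = v.
Proof.
move=> rk; have [c [r E]] : exists (c : 'cV[F]_3) (r : 'rV_3), sym_mx v = c *m r.
  move: (col_base (sym_mx v)) (row_base (sym_mx v)) (mulmx_base (sym_mx v)).
  by rewrite rk => c r <-; exists c, r.
have Eij i j : sym_mx v i j = c i 0 * r 0 j by rewrite E mxE big_ord1.
have sq_ex i : {s | s ^+ 2 == sym_mx v i i}.
  by apply: sigW; have [s <-] := sqr_surj (sym_mx v i i); exists s.
have M_sym i j : sym_mx v i j = sym_mx v j i by rewrite -[in LHS]sym_mx_sym mxE.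
have sqM i j : sval (sq_ex i) * sval (sq_ex j) = sym_mx v i j.
  apply: sqr_inj; rewrite exprMn (eqP (svalP (sq_ex i))) (eqP (svalP (sq_ex j))).
  by rewrite expr2 {2}[sym_mx v i j]M_sym !Eij; ring.
pose u := \row_i sval (sq_ex i).
have Eu : veronese_map u = v.
  apply: (can_inj (@sym_mxK F)); rewrite sym_mx_veronese.
  by apply/matrixP=> i j; rewrite [LHS]mxE big_ord1 [u^T _ _]mxE ![u _ _]mxE sqM.
exists u => //; apply: contra_eq_neq rk => u0.
by rewrite -Eu (eqP (_ : veronese_map u == 0)) ?veronese_map_eq0 ?u0 // linear0 mxrank0.
Qed.

(** The singular vectors are those of the nucleus point, q in number with 0, and the q - 1 nonzero
    vectors of each rank-2 point outside the nucleus plane. *)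
Lemma OD0_singular U k : admissible_plane U -> (k <= 3)%N ->
  #|[set v in U | \det (sym_mx v) == 0]| = (#|F| + k * #|F| * #|F|.-1)%N ->
  OD0 U = [:: 0; 1; k * #|F|; #|F| ^ 2 + #|F| - k * #|F|]%N.
Proof.
move=> /and3P[/eqP dU /disjoint_veroneseP UV /eqP dUN] k3 S.
have q1 : (1 < #|F|)%N by apply: finNzRing_gt1.
have rank1 v : v \in U -> (\rank (sym_mx v) == 1%N) = false.
  move=> vU; apply/negP => /eqP /rank1_veronese[u u0 Hu].
  by have /negP[] := UV u u0; rewrite Hu.
have sing v : (\det (sym_mx v) == 0) = (\rank (sym_mx v) != 3)%N.
  rewrite -[_ == 3%N]/(row_free (sym_mx v)) row_free_unit unitmxE unitfE.
  by rewrite negbK.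
have singN v : v \in nucleus_plane F -> \det (sym_mx v) == 0.
  rewrite memv_nucleus_plane (row6_eta v) det_sym_row6 !row6E.
  by case/and3P=> /eqP-> /eqP-> /eqP->; rewrite !mul0r !addr0.
have E1 : #|[set W in points U | point_rank W == 1%N]| = 0%N.
  apply/eqP; rewrite -(eqn_pmul2r (_ : 0 < #|F|.-1)%N); last by lia.
  rewrite -card_points mul0n cards_eq0; apply/eqP/setP=> v; rewrite !inE.
  apply/and3P=> -[vU v0]; by rewrite point_rank_line // rank1.
have EN : #|points (U :&: nucleus_plane F)| = 1%N.
  apply/eqP; rewrite -(eqn_pmul2r (_ : 0 < #|F|.-1)%N); last by lia.
  rewrite (_ : points _ = [set W in points (U :&: nucleus_plane F) | predT W]).
    rewrite -card_points; have := cardsD1 0 [set v in (U :&: nucleus_plane F)%VS].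
    rewrite inE mem0v cardsE card_vspace dUN expn1 mul1n => ->; apply/eqP.
    by apply: eq_card => v; rewrite !inE andbT andbC.
  by apply/setP=> W; rewrite [RHS]inE andbT.
have E2 : #|[set W in points U | (point_rank W == 2) && ~~ (W <= nucleus_plane F)%VS]|
     = (k * #|F|)%N.
  apply/eqP; rewrite -(eqn_pmul2r (_ : 0 < #|F|.-1)%N); last by lia.
  rewrite -card_points; apply/eqP.
  have := cardsID [set v in nucleus_plane F] [set v in U | \det (sym_mx v) == 0].
  rewrite S (_ : _ :&: _ = [set v in (U :&: nucleus_plane F)%VS]); last first.
    apply/setP => v; rewrite !inE [RHS]memv_cap -andbA; congr (_ && _).
    by case: (boolP (v \in nucleus_plane F)) => [/singN->|]; rewrite ?andbF.
  rewrite [in X in (X + _)%N]cardsE card_vspace dUN expn1 => /addnI <-.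
  apply: eq_card => v; rewrite !inE.
  have [vU|] := boolP (v \in U); last by rewrite ?andbF.
  have [->|v0] := eqVneq v 0; first by rewrite mem0v.
  rewrite point_rank_line // -memvE sing /= andbC.
  have := rank_leq_row (sym_mx v); have := rank1 v vU.
  have : \rank (sym_mx v) != 0%N.
    rewrite mxrank_eq0; apply: contraNneq v0 => E.
    by rewrite -(sym_mxK v) E linear0.
  by case: (\rank _) => [|[|[|[|]]]].
have E3 : #|[set W in points U | point_rank W == 3%N]| = (#|F| ^ 2 + #|F| - k * #|F|)%N.
  apply/eqP; rewrite -(eqn_pmul2r (_ : 0 < #|F|.-1)%N); last by lia.
  rewrite -card_points; apply/eqP.
  have := cardsID [set v | \det (sym_mx v) == 0] [set v in U].
  rewrite [#|[set v in U]|]cardsE card_vspace dU.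
  rewrite (_ : _ :&: _ = [set v in U | \det (sym_mx v) == 0]); last first.
    by apply/setP=> v; rewrite !inE.
  rewrite S (_ : _ :\: _ = [set v in U | (v != 0) && (point_rank <[v]>%VS == 3%N)]).
    (* As k <= 3 <= q + 1, the truncated subtraction is exact. *)
    have le : (k * #|F| <= #|F| ^ 2 + #|F|)%N.
      by move: q1 k3; rewrite -mulnn; case: #|F| => [|[|n]] // _; nia.
    move: q1 (subnK le); set N := #|[set v in U | _]|; set M := (_ - _)%N.
    by move: N M; case: #|F| => // n N M _; rewrite !expnS expn0 /=; nia.
  apply/setP=> v; rewrite !inE.
  have [->|v0] := eqVneq v 0; first by rewrite singN ?mem0v //= andbF.
  by rewrite point_rank_line // sing negbK andbC.
by rewrite /OD0 E1 EN E2 E3.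
Qed.

(** * Planes in normal position *)

(* The nucleus point of the plane is (0,1,0,0,0,0) if s, else (0,0,1,0,0,0).   *)
Definition plane_pt (s : bool) (a b c d X Y t : F) : 'rV[F]_6 :=
  if s then row6 X t (a * X + b * Y) Y (c * X + d * Y) 0
  else row6 X (a * X + b * Y) t Y (c * X + d * Y) 0.

Definition plane_mx (s : bool) (a b c d : F) : 'M[F]_(3, 6) :=
  \matrix_(i, j) nth 0 [:: plane_pt s a b c d 1 0 0; plane_pt s a b c d 0 1 0;
                           plane_pt s a b c d 0 0 1] i 0 j.

Definition nplane (s : bool) (a b c d : F) : {vspace 'rV[F]_6} :=
  limg (linfun (mulmxr (plane_mx s a b c d))).

Lemma plane_ptE s a b c d (w : 'rV[F]_3) :
  w *m plane_mx s a b c d = plane_pt s a b c d (w 0 0) (w 0 1) (w 0 2).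
Proof.
apply/rowP=> k; rewrite mxE !big_ord_recl big_ord0 !mxE.
rewrite (_ : lift ord0 ord0 = 1); last exact/val_inj.
rewrite (_ : lift ord0 (lift ord0 ord0) = 2); last exact/val_inj.
rewrite -[ord0]/(0 : 'I_3).
by case: s; rewrite /plane_pt /=; case6 k; rewrite !mxE /=; ring.
Qed.

Lemma nplaneP s a b c d v :
  reflect (exists X Y t, v = plane_pt s a b c d X Y t) (v \in nplane s a b c d).
Proof.
apply: (iffP memv_imgP) => [[w _ ->]|[X [Y [t ->]]]].
  by exists (w 0 0), (w 0 1), (w 0 2); rewrite lfunE /= plane_ptE.
exists (\row_j nth 0 [:: X; Y; t] j); first exact: memvf.
by rewrite lfunE /= plane_ptE !mxE.
Qed.

Lemma plane_pt_inj s a b c d X Y t X' Y' t' :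
  plane_pt s a b c d X Y t = plane_pt s a b c d X' Y' t' ->
  [/\ X = X', Y = Y' & t = t'].
Proof.
move=> /rowP E; have := (E 0, E 3, E (if s then 1 else 2)).
by rewrite /plane_pt; case: s {E}; rewrite !mxE => -[[]].
Qed.

Lemma nplane_dim s a b c d : \dim (nplane s a b c d) = 3%N.
Proof.
rewrite limg_dim_eq ?dimvf ?/dim //=.
apply/eqP; rewrite -subv0; apply/subvP=> w; rewrite memv_cap memvf memv_ker memv0.
rewrite lfunE /= plane_ptE => /eqP E.
have /plane_pt_inj[E0 E1 E2] : plane_pt s a b c d (w 0 0) (w 0 1) (w 0 2) =
   plane_pt s a b c d 0 0 0.
  rewrite E; apply/rowP=> k; rewrite mxE /plane_pt !mulr0 addr0.
  by case: s {E}; rewrite mxE; case6 k.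
apply/eqP/rowP=> k; rewrite mxE; case3 k;
  by [rewrite -[RHS]E0; congr (w _ _); exact/val_inj
     |rewrite -[RHS]E1; congr (w _ _); exact/val_inj
     |rewrite -[RHS]E2; congr (w _ _); exact/val_inj].
Qed.

Lemma nplane_nucleus_dim s a b c d :
  \dim (nplane s a b c d :&: nucleus_plane F) = 1%N.
Proof.
rewrite (_ : (_ :&: _)%VS = <[(plane_pt s a b c d 0 0 1)%R]>%VS).
  rewrite dim_vline; apply/eqP; rewrite eqb1; apply/eqP => /rowP E.
  have := (E 1, E 2); rewrite /plane_pt.
  by case: s {E}; rewrite !mxE /= => -[/eqP + /eqP]; rewrite oner_eq0.
have scale t : plane_pt s a b c d 0 0 t = t *: plane_pt s a b c d 0 0 1.
  apply/rowP=> k; rewrite /plane_pt.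
  by case: s; rewrite !mxE; case6 k => /=; ring.
apply/vspaceP=> v; rewrite memv_cap; apply/andP/vlineP => [[]|[t ->]].
  case/nplaneP=> X [Y [t ->]]; rewrite memv_nucleus_plane => H.
  have [-> ->] : X = 0 /\ Y = 0.
    by move: H; rewrite /plane_pt; case: (s); rewrite !row6E => /and3P[/eqP-> /eqP->].
  by exists t.
rewrite -scale; split; first by apply/nplaneP; exists 0, 0, t.
by rewrite memv_nucleus_plane /plane_pt; case: (s); rewrite !row6E eqxx.
Qed.

(** A Veronese point with y_5 = u_2^2 = 0 comes from u = (x, y, 0); the two equations compare its
    entries with [plane_pt]. *)
Lemma nplane_admissibleP s a b c d :
  reflect (forall x y, a * x ^+ 2 + b * y ^+ 2 = (if s then 0 else x * y) ->
             c * x ^+ 2 + d * y ^+ 2 = 0 -> x = 0 /\ y = 0)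
          (admissible_plane (nplane s a b c d)).
Proof.
rewrite /admissible_plane nplane_dim nplane_nucleus_dim eqxx andbT.
apply: (iffP (disjoint_veroneseP _)) => H.
  move=> x y E1 E2; pose u : 'rV[F]_3 := \row_j nth 0 [:: x; y; 0] j.
  have [/rowP u0|/H/negP[]] := eqVneq u 0.
    by split; [have := u0 0|have := u0 1]; rewrite !mxE.
  apply/nplaneP; exists (x ^+ 2), (y ^+ 2), (if s then x * y else 0).
  rewrite veronese_row3 !mxE /plane_pt E1 E2.
  by case: (s); congr row6; rewrite /= ?mulr0 ?expr0n.
move=> u u0; apply/nplaneP=> -[X [Y [t]]]; rewrite veronese_row3.
have u2 : (u 0 2 = 0 -> u 0 0 = 0 /\ u 0 1 = 0 -> False).
  move=> E2 [E0 E1]; case/eqP: u0; apply/rowP=> k; rewrite mxE; case3 k;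
  by [rewrite -[RHS]E0; congr (u _ _); exact/val_inj
     |rewrite -[RHS]E1; congr (u _ _); exact/val_inj
     |rewrite -[RHS]E2; congr (u _ _); exact/val_inj].
move=> /rowP E; have := (E 5); rewrite /plane_pt (fun_if (fun v : 'rV_6 => v 0 5)).
rewrite !row6E if_same => /eqP; rewrite expf_eq0 /= => /eqP E5.
apply: u2 => //; apply: H; move: (E 0) (E 3) (E 1) (E 2) (E 4); rewrite /plane_pt;
  by case: (s); rewrite !row6E E5 !mulr0 => <- <- H1 H2 H4; rewrite -?H1 -?H2 -?H4.
Qed.

Lemma singular_nplane s a b c d :
  #|[set v in nplane s a b c d | \det (sym_mx v) == 0]| =
  #|[set p : F * F * F | p.1.1 * (c * p.1.1 + d * p.1.2) ^+ 2 +
      p.1.2 * (if s then a * p.1.1 + b * p.1.2 else p.2) ^+ 2 == 0]|.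
Proof.
pose f (p : F * F * F) := plane_pt s a b c d p.1.1 p.1.2 p.2.
have finj : injective f.
  by move=> [[X Y] t] [[X' Y'] t'] /plane_pt_inj[/= -> -> ->].
rewrite -[RHS](card_imset _ finj); apply: eq_card => v; rewrite inE.
have detE p : \det (sym_mx (f p)) = p.1.1 * (c * p.1.1 + d * p.1.2) ^+ 2 +
      p.1.2 * (if s then a * p.1.1 + b * p.1.2 else p.2) ^+ 2.
  by rewrite /f /plane_pt; case: (s); rewrite det_sym_row6; ring.
apply/andP/imsetP => [[/nplaneP[X [Y [t ->]]]]|[p]].
  by rewrite -[plane_pt _ _ _ _ _ _ _ _]/(f (X, Y, t)) detE => H; exists (X, Y, t); rewrite ?inE.
rewrite inE -detE => H ->; split=> //.
by apply/nplaneP; exists p.1.1, p.1.2, p.2.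
Qed.

Lemma orbit_nplane A s a b c d s' a' b' c' d' : \det A != 0 ->
  (forall X Y t, congr_coord A (plane_pt s a b c d X Y t) \in nplane s' a' b' c' d') ->
  nplane s' a' b' c' d' \in orbit 'P (K F) (nplane s a b c d).
Proof.
move=> dA H; apply/mem_orbitK; exists A; first by rewrite unitmxE unitfE.
apply: collineation_eq; rewrite ?unitmxE ?unitfE ?nplane_dim //.
by move=> v /nplaneP[X [Y [t ->]]].
Qed.

(* With C = [a, b; c, d] and P = [p, q; r, s] the equations are C' P^(2) = P C. *)
Lemma orbit_nplane1 p q r s a b c d a' b' c' d' : p * s != q * r ->
  a' * p ^+ 2 + b' * r ^+ 2 = p * a + q * c ->
  a' * q ^+ 2 + b' * s ^+ 2 = p * b + q * d ->
  c' * p ^+ 2 + d' * r ^+ 2 = r * a + s * c ->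
  c' * q ^+ 2 + d' * s ^+ 2 = r * b + s * d ->
  nplane true a' b' c' d' \in orbit 'P (K F) (nplane true a b c d).
Proof.
move=> dP Ea Eb Ec Ed; apply: (@orbit_nplane (mx3 p q 0 r s 0 0 0 1)) => [|X Y t].
  by rewrite det_mx3 !(mulr0, mul0r, addr0, mulr1) addr_eq0 opp2.
apply/nplaneP; rewrite /plane_pt congr_row6.
exists (p ^+ 2 * X + q ^+ 2 * Y), (r ^+ 2 * X + s ^+ 2 * Y); eexists.
congr row6; try reflexivity; try by ring.
- rewrite (_ : a' * _ + b' * _ = (a' * p ^+ 2 + b' * r ^+ 2) * X +
     (a' * q ^+ 2 + b' * s ^+ 2) * Y); last by ring.
  by rewrite Ea Eb; ring.
- rewrite (_ : c' * _ + d' * _ = (c' * p ^+ 2 + d' * r ^+ 2) * X +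
     (c' * q ^+ 2 + d' * s ^+ 2) * Y); last by ring.
  by rewrite Ec Ed; ring.
Qed.

(** The congruence by the matrix with rows (p, n, m), (0, s, 0), (0, 0, u) fixes the nucleus point;
    the equations compare coefficients of X and Y in the image. *)
Lemma orbit_nplane2 p n m s u a b c d a' b' c' d' :
  p != 0 -> s != 0 -> u != 0 ->
  a' * p ^+ 2 = s * (p * a + m * c) ->
  a' * n ^+ 2 + b' * s ^+ 2 = s * (p * b + n + m * d) ->
  c' * p ^+ 2 = s * u * c ->
  c' * n ^+ 2 + d' * s ^+ 2 = s * u * d ->
  nplane false a' b' c' d' \in orbit 'P (K F) (nplane false a b c d).
Proof.
move=> p0 s0 u0 Ea Eb Ec Ed.
apply: (@orbit_nplane (mx3 p n m 0 s 0 0 0 u)) => [|X Y t].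
  by rewrite det_mx3 !(mulr0, mul0r, addr0, mulr1) !mulf_neq0.
apply/nplaneP; rewrite /plane_pt congr_row6.
exists (p ^+ 2 * X + n ^+ 2 * Y), (s ^+ 2 * Y); eexists.
congr row6; try reflexivity; try by ring.
- rewrite (_ : a' * _ + b' * _ = (a' * p ^+ 2) * X +
     (a' * n ^+ 2 + b' * s ^+ 2) * Y); last by ring.
  by rewrite Ea Eb; ring.
- rewrite (_ : c' * _ + d' * _ = (c' * p ^+ 2) * X +
     (c' * n ^+ 2 + d' * s ^+ 2) * Y); last by ring.
  by rewrite Ec Ed; ring.
Qed.

(* The left-hand side is v /\ C v^(2) for v = (x, y) and C = [a, b; c, d]: its  *)
(* zeros are the v such that C v^(2) is a multiple of v.                       *)
Definition rootfree (a b c d : F) : Prop :=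
  forall x y, x * (c * x ^+ 2 + d * y ^+ 2) + y * (a * x ^+ 2 + b * y ^+ 2) = 0 ->
    x = 0 /\ y = 0.

Lemma rootfree_lead a b c d : rootfree a b c d -> c != 0.
Proof.
move=> H; apply/eqP => c0; have [|/eqP] := H 1 0; first by rewrite c0; ring.
by rewrite oner_eq0.
Qed.

Lemma rootfree_irreducible a b c d : rootfree a b c d ->
  irreducible_poly (Poly [:: b; d; a; c]) /\ size (Poly [:: b; d; a; c]) = 4%N.
Proof.
move=> H; have c0 := rootfree_lead H.
have sz : size (Poly [:: b; d; a; c]) = 4%N by rewrite (@PolyK _ 0).
split=> //; apply: cubic_irreducible; rewrite ?sz // => x.
apply/negP; rewrite /root horner_Poly /= => /eqP E.
have [|_ /eqP] := H x 1; first by rewrite -[RHS]E; ring.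
by rewrite oner_eq0.
Qed.

(** Let P be the Moebius matrix from a root x of the first cubic to a root of the second. The cubics
    of C and adj(P) C0 P^(2) share the root x, hence are proportional, and so are the matrices,
    whose entries are the coefficients. Thus l C0 P^(2) = P C for a scalar l, and l P solves the
    equations of [orbit_nplane1]. *)
Lemma rootfree_orbit a b c d a0 b0 c0 d0 :
  rootfree a b c d -> rootfree a0 b0 c0 d0 ->
  nplane true a0 b0 c0 d0 \in orbit 'P (K F) (nplane true a b c d).
Proof.
move=> rf rf0; have c_neq0 := rootfree_lead rf; have c0_neq0 := rootfree_lead rf0.
have [irr sz] := rootfree_irreducible rf; have [irr0 sz0] := rootfree_irreducible rf0.
have [|| L [x [y [fx fy]]]] :=
  @common_root_ext F (Poly [:: b; d; a; c]) (Poly [:: b0; d0; a0; c0]).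
- by rewrite sz.
- by rewrite sz0.
have [p [q [r [s [det0 m0 Exy]]]]] := cubic_moebius irr irr0 sz sz0 fx fy.
(* [al, be; ga, de] = C0 P^(2) and [A, B; C, D] = adj(P) C0 P^(2): the latter   *)
(* is a multiple of [a, b; c, d] since both have x as a root of their cubic.   *)
pose al := a0 * p ^+ 2 + b0 * r ^+ 2; pose be := a0 * q ^+ 2 + b0 * s ^+ 2.
pose ga := c0 * p ^+ 2 + d0 * r ^+ 2; pose de := c0 * q ^+ 2 + d0 * s ^+ 2.
pose A := s * al + q * ga; pose B := s * be + q * de.
pose C := r * al + p * ga; pose D := r * be + p * de.
pose i : {rmorphism F -> L} := in_alg L.
have two0L : 2%:R = 0 :> L by rewrite -(rmorph_nat (in_alg L)) two0 rmorph0.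
have fx0 : i c * x ^+ 3 + i a * x ^+ 2 + i d * x + i b = 0.
  by move: fx; rewrite root_Poly_in_alg /= => /eqP <-; rewrite /i /=; ring.
have fy0 : i c0 * y ^+ 3 + i a0 * y ^+ 2 + i d0 * y + i b0 = 0.
  by move: fy; rewrite root_Poly_in_alg /= => /eqP <-; rewrite /i /=; ring.
have fx1 : i C * x ^+ 3 + i A * x ^+ 2 + i D * x + i B = 0.
  have := cubic_form_moebius two0L (Exy : i p * x + i q = y * (i r * x + i s)) fy0.
  by rewrite -!(rmorphD, rmorphM, rmorphXn).
have [EB ED EA] : [/\ c * B + C * b = 0, c * D + C * d = 0 & c * A + C * a = 0].
  apply: (cubic_root_indep irr sz fx).
  have := eliminate_cube two0L fx0 fx1.
  by rewrite -!(rmorphD, rmorphM, rmorphXn).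
have dt : p * s + q * r != 0 by rewrite -[q * r]opp2.
(* Otherwise adj(P) C0 P^(2) = 0, so C0 P^(2) = 0, and its second row gives c0 = 0. *)
have eqC : C != 0.
  apply/eqP => C0.
  have cancel z z' : c * z + C * z' = 0 -> z = 0.
    by rewrite C0 mul0r addr0 => /eqP; rewrite mulf_eq0 (negPf c_neq0) => /eqP.
  have ga0 : ga = 0.
    apply: (mulfI dt); rewrite mulr0 -[RHS](_ : r * A + s * C = 0); last first.
      by rewrite (cancel A a EA) C0 !mulr0 addr0.
    by rewrite /A /C; ring2.
  have de0 : de = 0.
    apply: (mulfI dt); rewrite mulr0 -[RHS](_ : r * B + s * D = 0); last first.
      by rewrite (cancel B b EB) (cancel D d ED) !mulr0 addr0.
    by rewrite /B /D; ring2.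
  have : c0 * (p * s + q * r) ^+ 2 = s ^+ 2 * ga + r ^+ 2 * de.
    by rewrite /ga /de; ring2.
  by move/eqP; rewrite ga0 de0 !mulr0 addr0 mulf_eq0 expf_eq0 /= (negPf c0_neq0) (negPf dt).
pose l := (p * s + q * r) * c / C.
have lC : l * C = (p * s + q * r) * c by rewrite /l divfK.
have l0 : l != 0 by rewrite /l !mulf_neq0 ?invr_eq0.
have char2_eq (u v : F) : u + v = 0 -> u = v.
  by move/eqP; rewrite addr_eq0 opp2 => /eqP.
move/char2_eq: EA => EA; move/char2_eq: EB => EB; move/char2_eq: ED => ED.
have lal : l * al = p * a + q * c.
  apply: (mulfI eqC); rewrite mulrA [C * l]mulrC lC.
  rewrite (_ : _ * al = p * (c * A) + q * c * C); first by rewrite EA; ring.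
  by rewrite /A /C; ring2.
have lbe : l * be = p * b + q * d.
  apply: (mulfI eqC); rewrite mulrA [C * l]mulrC lC.
  rewrite (_ : _ * be = p * (c * B) + q * (c * D)); first by rewrite EB ED; ring.
  by rewrite /B /D; ring2.
have lga : l * ga = r * a + s * c.
  apply: (mulfI eqC); rewrite mulrA [C * l]mulrC lC.
  rewrite (_ : _ * ga = r * (c * A) + s * c * C); first by rewrite EA; ring.
  by rewrite /A /C; ring2.
have lde : l * de = r * b + s * d.
  apply: (mulfI eqC); rewrite mulrA [C * l]mulrC lC.
  rewrite (_ : _ * de = r * (c * B) + s * (c * D)); first by rewrite EB ED; ring.
  by rewrite /B /D; ring2.
apply: (@orbit_nplane1 (l * p) (l * q) (l * r) (l * s)).
- rewrite -subr_eq0 (_ : _ - _ = l ^+ 2 * (p * s - q * r)); last by ring.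
  by rewrite mulf_neq0 ?expf_neq0.
- by rewrite [RHS](_ : _ = l * (p * a + q * c)); [rewrite -lal /al|]; ring.
- by rewrite [RHS](_ : _ = l * (p * b + q * d)); [rewrite -lbe /be|]; ring.
- by rewrite [RHS](_ : _ = l * (r * a + s * c)); [rewrite -lga /ga|]; ring.
- by rewrite [RHS](_ : _ = l * (r * b + s * d)); [rewrite -lde /de|]; ring.
Qed.

(** * Classification of planes in normal position *)

Lemma admissible_orbit U V :
  V \in orbit 'P (K F) U -> admissible_plane U -> admissible_plane V.
Proof. by case/mem_orbitK=> A uA <-; apply: admissible_plane_collineation. Qed.

(** If c != 0, the shift X + e^2 Y with c e^2 = d absorbs d, and a multiple of the last row removes
    a. If c = 0 and d != 0, such a multiple removes b. If c = d = 0, only the class of a b modulo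
    the elements n^2 + n matters, and it is nonzero by admissibility. *)
Lemma nplane2_classification b0 a b c d : ~~ artin_schreier b0 ->
  admissible_plane (nplane false a b c d) ->
  [|| nplane false 1 b0 0 0 \in orbit 'P (K F) (nplane false a b c d),
      nplane false 1 0 0 1 \in orbit 'P (K F) (nplane false a b c d)
    | nplane false 0 1 1 0 \in orbit 'P (K F) (nplane false a b c d)].
Proof.
move=> nb0 /nplane_admissibleP H; have [c0|c0] := eqVneq c 0; last first.
  have [e Ee] := sqr_surj (d / c).
  have cE : c * e ^+ 2 = d by rewrite Ee mulrC divfK.
  pose k := b + e + a * e ^+ 2.
  (* Otherwise the plane contains the Veronese point of (e, 1, 0). *)
  have k0 : k != 0.
    apply/eqP=> k0; have [||_ /eqP] := H e 1; last by rewrite oner_eq0.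
      apply/eqP; rewrite -subr_eq0; apply/eqP; rewrite -[RHS]k0 /k; ring2.
    by rewrite cE; ring2.
  have kc : k / (k * c) * c = 1 by rewrite mulrAC divff ?mulf_neq0.
  apply/or3P/Or33; apply: (@orbit_nplane2 1 e (a / c) k (k * c)^-1);
    rewrite ?oner_eq0 ?invr_eq0 ?mulf_neq0 //.
  - by rewrite divfK //; ring2.
  - rewrite (_ : a / c * d = a * e ^+ 2); first by rewrite /k; ring.
    by rewrite -cE mulrA divfK.
  - by rewrite kc expr1n mulr1.
  - by rewrite -cE [RHS]mulrA kc; ring.
have a0 : a != 0.
  apply/eqP=> a0; have [||/eqP] := H 1 0; rewrite ?oner_eq0 //.
  - by rewrite a0; ring.
  - by rewrite c0; ring.
have [d0|d0] := eqVneq d 0; last first.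
  apply/or3P/Or32; apply: (@orbit_nplane2 a 0 (a * b / d) 1 d^-1);
    rewrite ?oner_eq0 ?invr_eq0 //.
  - by rewrite c0; ring.
  - by rewrite divfK //; ring2.
  - by rewrite c0; ring.
  - by rewrite [RHS](_ : _ = 1); [ring | rewrite mul1r mulVf].
have ab : ~~ artin_schreier (a * b).
  apply/artin_schreierP=> -[m Em]; have [||_ /eqP] := H (m / a) 1; last by rewrite oner_eq0.
    have am : a * (m / a) = m by rewrite mulrC divfK.
    apply: (mulfI a0); rewrite mulr1 am.
    rewrite [LHS](_ : _ = (a * (m / a)) ^+ 2 + a * b); last by ring.
    by rewrite am -Em; ring2.
  by rewrite c0 d0; ring.
have /artin_schreierP[n En] := artin_schreier_index2 ab nb0.
apply/or3P/Or31; apply: (@orbit_nplane2 a n 0 1 1); rewrite ?oner_eq0 ?c0 ?d0 //; try by ring.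
have -> : b0 = n ^+ 2 + n + a * b by rewrite En; ring2.
by ring2.
Qed.

(** The matrix P = [1, d m; 0, d] normalises d to 1 and replaces b / d^2 by b / d^2 + m^2 + m. *)
Lemma nplane1_triangular b0 b d : ~~ artin_schreier b0 ->
  admissible_plane (nplane true 1 b 0 d) ->
  (nplane true 1 0 0 1 \in orbit 'P (K F) (nplane true 1 b 0 d)) ||
  (nplane true 1 b0 0 1 \in orbit 'P (K F) (nplane true 1 b 0 d)).
Proof.
move=> nb0 /nplane_admissibleP H.
have d0 : d != 0.
  apply/eqP=> d0; have [e Ee] := sqr_surj b.
  have [||_ /eqP] := H e 1; rewrite ?oner_eq0 // ?Ee ?d0; by ring2.
have act b' m : m ^+ 2 + m = b / d ^+ 2 + b' ->
    nplane true 1 b' 0 1 \in orbit 'P (K F) (nplane true 1 b 0 d).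
  move=> Em; apply: (@orbit_nplane1 1 (d * m) 0 d); try by ring.
    by rewrite mulr0 mul1r.
  have -> : b' = m ^+ 2 + m + b / d ^+ 2 by rewrite Em; ring2.
  rewrite (_ : _ + _ = (d * m) ^+ 2 + (m ^+ 2 + m) * d ^+ 2 + b / d ^+ 2 * d ^+ 2); last by ring.
  by rewrite divfK ?expf_neq0 //; ring2.
have [/artin_schreierP[m Em]|nb] := boolP (artin_schreier (b / d ^+ 2)).
  by rewrite (act 0 m) // addr0.
have /artin_schreierP[m Em] := artin_schreier_index2 nb nb0.
by rewrite (act b0 m) ?orbT.
Qed.

(** If C v^(2) = v and P has first column v, then P^-1 C P^(2) has first column (1, 0). *)
Lemma nplane1_eigenvector a b c d x y : (x != 0) || (y != 0) ->
  a * x ^+ 2 + b * y ^+ 2 = x -> c * x ^+ 2 + d * y ^+ 2 = y ->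
  exists b' d', nplane true 1 b' 0 d' \in orbit 'P (K F) (nplane true a b c d).
Proof.
have [->|x0] := eqVneq x 0 => /= y0 Ex Ey.
  exists (c / y), a; rewrite orbit_sym; apply: (@orbit_nplane1 0 1 y 0).
  - by rewrite mul0r mul1r eq_sym.
  - by rewrite [LHS]Ex; ring.
  - by ring.
  - by rewrite [LHS]Ey; ring.
  - by rewrite [y * _]mulrC divfK //; ring.
exists (b / x), (d + y * (b / x)); rewrite orbit_sym; apply: (@orbit_nplane1 x 0 y 1).
- by rewrite mul0r mulr1.
- by rewrite [LHS]Ex; ring.
- by rewrite [x * _]mulrC divfK //; ring.
- by rewrite [LHS]Ey; ring.
- by ring2.
Qed.

Lemma nplane1_classification b0 c0 a b c d :
  ~~ artin_schreier b0 -> rootfree 0 c0 1 1 ->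
  admissible_plane (nplane true a b c d) ->
  [|| nplane true 1 0 0 1 \in orbit 'P (K F) (nplane true a b c d),
      nplane true 1 b0 0 1 \in orbit 'P (K F) (nplane true a b c d)
    | nplane true 0 c0 1 1 \in orbit 'P (K F) (nplane true a b c d)].
Proof.
move=> nb0 rf0 ns; have /nplane_admissibleP H := ns.
have [/existsP[[x y] /= /andP[xy0 /eqP E]]|nroot] := boolP [exists v : F * F,
   ((v.1 != 0) || (v.2 != 0)) && (v.1 * (c * v.1 ^+ 2 + d * v.2 ^+ 2) +
      v.2 * (a * v.1 ^+ 2 + b * v.2 ^+ 2) == 0)]; last first.
  apply/or3P/Or33; apply: rootfree_orbit => // x y E.
  have := nroot; rewrite negb_exists => /forallP/(_ (x, y)).
  by rewrite /= E eqxx andbT negb_or !negbK => /andP[/eqP-> /eqP->].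
(* At a zero v of the cubic, C v^(2) = l v, with l != 0 by admissibility; then v / l is fixed, as C
   v^(2) is quadratic in v. *)
have [l l0 [Ex Ey]] : exists2 l, l != 0 &
    a * x ^+ 2 + b * y ^+ 2 = l * x /\ c * x ^+ 2 + d * y ^+ 2 = l * y.
  have nz : (a * x ^+ 2 + b * y ^+ 2 != 0) || (c * x ^+ 2 + d * y ^+ 2 != 0).
    rewrite -negb_and; apply: contraL xy0 => /andP[/eqP E1 /eqP E2].
    by have [-> ->] := H x y E1 E2; rewrite eqxx.
  move: nz E; set w1 := (a * _ + _); set w2 := (c * _ + _) => nz E.
  have E' : x * w2 = y * w1 by apply/eqP; rewrite -subr_eq0 opp2 E.
  have [x0|x0] := eqVneq x 0.
    move: xy0 E'; rewrite x0 eqxx mul0r /= => y0 /esym/eqP.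
    rewrite mulf_eq0 (negPf y0) /= => /eqP w10; move: nz; rewrite w10 eqxx /= => w20.
    by exists (w2 / y); rewrite ?mulr0 ?divfK // mulf_neq0 ?invr_eq0.
  exists (w1 / x); last by rewrite divfK // mulrAC [w1 * y]mulrC -E' mulrC mulKf.
  rewrite mulf_neq0 ?invr_eq0 //; apply: contraTneq nz => w10.
  move: E'; rewrite w10 mulr0 => /eqP; rewrite mulf_eq0 (negPf x0) /= => /eqP ->.
  by rewrite eqxx.
have [|||b' [d' H']] := @nplane1_eigenvector a b c d (x / l) (y / l).
- by rewrite !mulf_eq0 !invr_eq0 (negPf l0) !orbF.
- rewrite [LHS](_ : _ = (a * x ^+ 2 + b * y ^+ 2) * (l^-1 * l^-1)); last by ring.
  by rewrite Ex mulrA [l * x]mulrC mulfK.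
- rewrite [LHS](_ : _ = (c * x ^+ 2 + d * y ^+ 2) * (l^-1 * l^-1)); last by ring.
  by rewrite Ey mulrA [l * y]mulrC mulfK.
have /orP[H2|H2] := nplane1_triangular nb0 (admissible_orbit H' ns);
  by rewrite (orbit_trans H2 H') ?orbT.
Qed.

(** * Reduction to normal position *)

Lemma nucleus_vector_ex U : admissible_plane U ->
  exists v, [/\ v \in U, v != 0 & v \in nucleus_plane F].
Proof.
move=> /and3P[_ _ /eqP dUN]; have := memv_pick (U :&: nucleus_plane F)%VS.
rewrite memv_cap => /andP[vU vN]; exists (vpick (U :&: nucleus_plane F)%VS).
by rewrite vU vN vpick0 -dimv_eq0 dUN.
Qed.

(** The nucleus vector has zero diagonal, so the diagonal map from the plane to F^3 is not
    injective, hence not onto. *)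
Lemma diagonal_relation U : admissible_plane U ->
  exists s : 'rV[F]_3, s != 0 /\
    forall v, v \in U -> s 0 0 * v 0 0 + s 0 1 * v 0 3 + s 0 2 * v 0 5 = 0.
Proof.
move=> nsU; have [w [wU w0 wN]] := nucleus_vector_ex nsU.
have dU : \dim U = 3%N by case/and3P: nsU => /eqP.
pose dg (j : 'I_3) : 'I_6 := nth 0 [:: 0; 3; 5] j.
pose X : 3.-tuple 'rV[F]_6 := tcast dU (vbasis U).
have XU : basis_of U X.
  have E : X = vbasis U :> seq _ by rewrite /X val_tcast.
  by rewrite E; apply: vbasisP.
pose G := \matrix_(i < 3, j < 3) X`_i 0 (dg j).
have coordG v : v \in U -> (\row_i coord X i v) *m G = \row_j v 0 (dg j).
  move=> vU; apply/rowP=> j; rewrite !mxE [in RHS](coord_basis XU vU) summxE.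
  by apply: eq_bigr => i _; rewrite !mxE.
have /det0P[s s0 sG] : \det G^T == 0.
  rewrite det_tr; apply/det0P; exists (\row_i coord X i w).
    apply: contraNneq w0 => /rowP E; rewrite (coord_basis XU wU) big1 // => i _.
    by have := E i; rewrite !mxE => ->; rewrite scale0r.
  rewrite coordG //; apply/rowP=> j; rewrite !mxE.
  move: wN; rewrite memv_nucleus_plane => /and3P[/eqP E0 /eqP E3 /eqP E5].
  by rewrite /dg; case3 j.
exists s; split=> // v vU.
have : (\row_i coord X i v) *m G *m s^T = 0.
  by rewrite -mulmxA -[G *m s^T]trmxK trmx_mul trmxK sG trmx0 mulmx0.
rewrite coordG // => /matrixP/(_ 0 0); rewrite !mxE !big_ord_recl big_ord0 !mxE addr0 addrA.
by rewrite /dg /= => <-; rewrite ![s _ _ * _]mulrC; congr (_ + _ + _);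
  congr (_ * _); congr (s _ _); exact/val_inj.
Qed.

Lemma completing_row (r : 'rV[F]_3) : r != 0 ->
  exists a b c d e f, \det (mx3 a b c d e f (r 0 0) (r 0 1) (r 0 2)) != 0.
Proof.
move=> r0; have [r2|r2] := eqVneq (r 0 2) 0; last first.
  by exists 1, 0, 0, 0, 1, 0; rewrite det_mx3 (_ : _ + _ = r 0 2) //; ring.
have [r1|r1] := eqVneq (r 0 1) 0; last first.
  by exists 1, 0, 0, 0, 0, 1; rewrite det_mx3 (_ : _ + _ = r 0 1) //; ring.
exists 0, 1, 0, 0, 0, 1; rewrite det_mx3 (_ : _ + _ = r 0 0); last by ring.
apply: contraNneq r0 => r0; apply/eqP/rowP=> k; rewrite mxE; case3 k;
  by [rewrite -[RHS]r0; congr (r _ _); exact/val_inj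
     |rewrite -[RHS]r1; congr (r _ _); exact/val_inj
     |rewrite -[RHS]r2; congr (r _ _); exact/val_inj].
Qed.

(** With the square roots of the coefficients of the relation as last row of A, the relation says
    that the last diagonal entry of A M A^T is 0. *)
Lemma orbit_y5_eq0 U : admissible_plane U ->
  exists2 V, V \in orbit 'P (K F) U & forall v, v \in V -> v 0 5 = 0.
Proof.
move=> /diagonal_relation[s [s0 Hs]].
have [r0 Er0] := sqr_surj (s 0 0); have [r1 Er1] := sqr_surj (s 0 1).
have [r2 Er2] := sqr_surj (s 0 2).
pose r : 'rV[F]_3 := \row_j nth 0 [:: r0; r1; r2] j.
have [|a [b [c [d [e [f dA]]]]]] := @completing_row r.
  apply: contraNneq s0 => /rowP E; have := (E 0, E 1, E 2); rewrite !mxE /= => -[[E0 E1] E2].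
  apply/eqP/rowP=> k; rewrite mxE; case3 k;
  by [rewrite (_ : Ordinal _ = 0) -?Er0 ?E0 ?expr0n //; exact/val_inj
     |rewrite (_ : Ordinal _ = 1) -?Er1 ?E1 ?expr0n //; exact/val_inj
     |rewrite (_ : Ordinal _ = 2) -?Er2 ?E2 ?expr0n //; exact/val_inj].
move: dA; rewrite !mxE /= => dA.
exists (collineation (mx3 a b c d e f r0 r1 r2) U).
  by apply: orbitK_collineation; rewrite unitmxE unitfE.
move=> _ /memv_imgP[v vU ->]; rewrite lfunE /= [v]row6_eta congr_row6 row6E.
by rewrite Er0 Er1 Er2 Hs.
Qed.

(** The kernel of (y_0, y_3) on the plane is its nucleus point, so this map is onto F^2; lifts of
    the unit vectors provide a, b, c, d. *)
Lemma nplane_of_vector (s : bool) U : admissible_plane U ->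
  (forall v, v \in U -> v 0 5 = 0) -> plane_pt s 0 0 0 0 0 0 1 \in U ->
  exists a b c d, U = nplane s a b c d.
Proof.
move=> nsU U5 eU.
have dU : \dim U = 3%N by case/and3P: nsU => /eqP.
have dUN : \dim (U :&: nucleus_plane F) = 1%N by case/and3P: nsU => _ _ /eqP.
pose E : 'M[F]_(6, 2) := \matrix_(k, j) (k == nth 0 [:: 0; 3] j)%:R.
have gE v : v *m E = \row_j v 0 (nth 0 [:: 0; 3] j).
  apply/rowP=> j; rewrite !mxE (bigD1 (nth 0 [:: 0; 3] j)) //= mxE eqxx mulr1.
  by rewrite big1 ?addr0 // => k nk; rewrite mxE (negPf nk) mulr0.
have onto : (linfun (mulmxr E) @: U)%VS = fullv.
  apply/eqP; rewrite eqEdim subvf dimvf /dim /= mul1n.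
  have := limg_ker_dim (linfun (mulmxr E)) U; rewrite dU.
  rewrite (_ : _ :&: _ = U :&: nucleus_plane F)%VS ?dUN => [/(@addnI 1 _ 2) ->//|].
  apply/vspaceP=> v; rewrite !memv_cap; case: (boolP (v \in U)) => //= vU.
  rewrite memv_ker lfunE /= gE -!memv_cap memv_nucleus_plane U5 // eqxx andbT.
  apply/eqP/andP=> [/rowP H|[/eqP v0 /eqP v3]].
    by have := (H 0, H 1); rewrite !mxE /= => -[-> ->].
  by apply/rowP=> j; rewrite !mxE; case: j => [[|[|//]] ?].
have pre x y : exists2 v, v \in U & v 0 0 = x /\ v 0 3 = y.
  have /memv_imgP[v vU] : \row_(j < 2) nth 0 [:: x; y] j \in (linfun (mulmxr E) @: U)%VS.
    by rewrite onto memvf.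
  rewrite lfunE /= gE => /rowP H; exists v => //.
  by have := (H 0, H 1); rewrite !mxE /= => -[-> ->].
have [u uU [u0 u3]] := pre 1 0; have [w wU [w0 w3]] := pre 0 1.
pose j : 'I_6 := if s then 2 else 1.
exists (u 0 j), (w 0 j), (u 0 4), (w 0 4).
apply/eqP; rewrite eq_sym eqEdim nplane_dim dU leqnn andbT.
apply/subvP=> _ /nplaneP[X [Y [t ->]]].
pose k : 'I_6 := if s then 1 else 2.
rewrite (_ : plane_pt _ _ _ _ _ _ _ _ = X *: u + Y *: w +
   (t - X * u 0 k - Y * w 0 k) *: plane_pt s 0 0 0 0 0 0 1).
  by rewrite !memvD ?memvZ.
have u5 := U5 u uU; have w5 := U5 w wU.
rewrite [u in X *: u]row6_eta [w in Y *: w]row6_eta u0 u3 w0 w3 u5 w5 /plane_pt /j /k.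
by apply/rowP=> i; case: s {eU j k}; rewrite !mxE; case6 i => /=; ring.
Qed.

(** If the nucleus vector, an alternating matrix, has nonzero third column, a congruence with last
    row (0, 0, 1), which keeps y_5 = 0, moves it to (0,0,1,0,0,0). Otherwise it is a multiple of
    (0,1,0,0,0,0). *)
Lemma orbit_nplane_ex U : admissible_plane U ->
  exists s a b c d, nplane s a b c d \in orbit 'P (K F) U.
Proof.
move=> nsU; have [V VU V5] := orbit_y5_eq0 nsU.
have nsV := admissible_orbit VU nsU.
have [v [vV v0 vN]] := nucleus_vector_ex nsV.
have Ev : v = row6 0 (v 0 1) (v 0 2) 0 (v 0 4) 0.
  move: vN; rewrite memv_nucleus_plane => /and3P[/eqP E0 /eqP E3 /eqP E5].
  by rewrite {1}[v]row6_eta E0 E3 E5.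
have case2 A : \det A != 0 -> A 2 0 = 0 -> A 2 1 = 0 ->
    congr_coord A v = row6 0 0 1 0 0 0 ->
    exists s a b c d, nplane s a b c d \in orbit 'P (K F) U.
  move=> dA A0 A1 Av; have uA : A \in unitmx by rewrite unitmxE unitfE.
  have WV := orbitK_collineation V uA.
  have WU := orbit_trans WV VU.
  have [||a [b [c [d E]]]] := @nplane_of_vector false (collineation A V) (admissible_orbit WV nsV).
  - move=> _ /memv_imgP[w wV ->]; rewrite lfunE /= [w]row6_eta [A]mx3_eta congr_row6 row6E.
    by rewrite A0 A1 (V5 w wV); ring.
  - apply/memv_imgP; exists v => //; rewrite lfunE /= Av /plane_pt.
    by congr row6; ring.
  by exists false, a, b, c, d; rewrite -E.
have [v2|v2] := eqVneq (v 0 2) 0; last first.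
  (* The second row spans the radical of the alternating form v. *)
  apply: (case2 (mx3 (v 0 2)^-1 0 0 (v 0 4) (v 0 2) (v 0 1) 0 0 1)); rewrite ?mxE //.
    by rewrite det_mx3 [X in X != 0](_ : _ = (v 0 2)^-1 * v 0 2); [rewrite mulVf ?oner_eq0 | ring].
  have iv : (v 0 2)^-1 * v 0 2 = 1 by rewrite mulVf.
  rewrite Ev congr_row6 !row6E; move: (v 0 2)^-1 iv => i iv.
  congr row6; try by ring2.
  by rewrite -[RHS]iv; ring2.
have [v4|v4] := eqVneq (v 0 4) 0; last first.
  apply: (case2 (mx3 0 (v 0 4)^-1 0 1 0 (v 0 1 / v 0 4) 0 0 1)); rewrite ?mxE //.
    by rewrite det_mx3 [X in X != 0](_ : _ = (v 0 4)^-1); [rewrite invr_eq0 | ring].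
  have iv : (v 0 4)^-1 * v 0 4 = 1 by rewrite mulVf.
  rewrite Ev v2 congr_row6 !row6E; move: (v 0 4)^-1 iv => i iv.
  congr row6; try by ring2.
    rewrite (_ : _ + _ = v 0 1 * i * (1 + i * v 0 4)); last by ring.
    by rewrite iv; ring2.
  by rewrite -[RHS]iv; ring2.
have v1 : v 0 1 != 0.
  apply: contraNneq v0 => v1; rewrite Ev v1 v2 v4.
  by apply/eqP/rowP=> k; rewrite !mxE; case6 k.
have [|a [b [c [d E]]]] := @nplane_of_vector true V nsV V5.
  rewrite (_ : plane_pt _ _ _ _ _ _ _ _ = (v 0 1)^-1 *: v) ?memvZ //.
  rewrite [v in RHS]Ev v2 v4 /plane_pt; apply/rowP=> k; rewrite !mxE.
  by case6 k; rewrite /= ?mulVf //; ring.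
by exists true, a, b, c, d; rewrite -E.
Qed.

(** * The six representatives *)

Lemma singular_count s a b c d n0 n1 :
  #|[set p : F * F | p.1 * (c * p.1) ^+ 2 == 0]| = n0 ->
  (forall Y, Y != 0 ->
     #|[set p : F * F | p.1 * (c * p.1 + d * Y) ^+ 2 +
          Y * (if s then a * p.1 + b * Y else p.2) ^+ 2 == 0]| = n1) ->
  #|[set v in nplane s a b c d | \det (sym_mx v) == 0]| = (n0 + n1 * #|F|.-1)%N.
Proof.
move=> E0 E1; rewrite singular_nplane -sum1_card (partition_big (fun p => p.1.2) predT) //=.
have fiber Y : \sum_(p in [set p : F * F * F | p.1.1 * (c * p.1.1 + d * p.1.2) ^+ 2 +
      p.1.2 * (if s then a * p.1.1 + b * p.1.2 else p.2) ^+ 2 == 0] | p.1.2 == Y) 1 =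
   #|[set p : F * F | p.1 * (c * p.1 + d * Y) ^+ 2 +
          Y * (if s then a * p.1 + b * Y else p.2) ^+ 2 == 0]| :> nat.
  have inj : injective (fun p : F * F => (p.1, Y, p.2)) by move=> [? ?] [? ?] /= [-> ->].
  rewrite sum1_card -(card_imset _ inj); apply: eq_card => -[[X Y'] t].
  rewrite -[LHS]topredE /= inE /=; apply/andP/imsetP => [[H /eqP EY]|[p + [-> -> ->]]].
    by exists (X, t); rewrite ?inE /= -EY.
  by rewrite inE eqxx.
rewrite (bigD1 0) //= fiber; congr (_ + _)%N.
  by rewrite -E0; apply: eq_card => p; rewrite !inE mulr0 addr0 mul0r addr0.
rewrite (eq_bigr (fun _ => n1)) => [|Y Y0]; last by rewrite fiber E1.
rewrite sum_nat_const mulnC; congr (_ * _)%N.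
by rewrite (eq_card (B := predC1 0)) ?cardC1.
Qed.

Lemma card_slice (A : {set F}) : #|[set p : F * F | p.1 \in A]| = (#|A| * #|F|)%N.
Proof.
rewrite -cardsT -cardsX; apply: eq_card => p.
by rewrite !inE andbT.
Qed.

Lemma card_graph (h : F -> F) (P : pred (F * F)) :
  (forall x y, P (x, y) = (y == h x)) -> #|[set p | P p]| = #|F|.
Proof.
move=> H; have inj : injective (fun x => (x, h x)) by move=> x y [].
rewrite -(card_imset _ inj); apply: eq_card => -[x y]; rewrite inE H.
by apply/eqP/imsetP => [->|[z _ [-> ->]]//]; exists x.
Qed.

Lemma artin_schreier_anisotropic b x y :
  ~~ artin_schreier b -> x ^+ 2 + x * y + b * y ^+ 2 = 0 -> x = 0 /\ y = 0.
Proof.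
move=> nb E; have [y0|y0] := eqVneq y 0.
  by move/eqP: E; rewrite y0 mulr0 expr0n /= mulr0 !addr0 expf_eq0 /= => /eqP ->.
case/artin_schreierP: nb; exists (x / y); apply: (mulIf (expf_neq0 2 y0)).
move: E; rewrite -[x in LHS](divfK y0); move: (x / y) => z E.
by apply/eqP; rewrite -subr_eq0 -[X in _ == X]E; apply/eqP; ring2.
Qed.

Section Representatives.
Variables (b0 c0 : F) (nb0 : ~~ artin_schreier b0) (nc0 : forall n : F, n ^+ 3 + n != c0).

Lemma rootfree_c0 : rootfree 0 c0 1 1.
Proof.
move=> x y E; have [y0|y0] := eqVneq y 0.
  split=> //; move/eqP: E; rewrite (_ : _ + _ = x ^+ 3); last by rewrite y0; ring.
  by rewrite expf_eq0 => /eqP.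
have /eqP[] := nc0 (x / y); apply: (mulIf (expf_neq0 3 y0)).
move: E; rewrite -[x in LHS](divfK y0); move: (x / y) => z E.
by apply/eqP; rewrite -subr_eq0 -[X in _ == X]E; apply/eqP; ring2.
Qed.

(** The cubics of the first three planes are x y (x + y), y (x^2 + x y + b0 y^2) and x^3 + x y^2 +
    c0 y^3, with 3, 1 and 0 zeros. *)
Definition rep (i : 'I_6) : {vspace 'rV[F]_6} :=
  nth 0%VS [:: nplane true 1 0 0 1; nplane true 1 b0 0 1; nplane true 0 c0 1 1;
     nplane false 1 b0 0 0; nplane false 1 0 0 1; nplane false 0 1 1 0] i.

(* rep i has rep_k i * q points of rank 2 outside the nucleus plane.           *)
Definition rep_k (i : 'I_6) : nat := nth 0%N [:: 3; 1; 0; 2; 2; 1]%N i.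

Lemma rep_admissible i : admissible_plane (rep i).
Proof.
case6 i; rewrite /rep /=; apply/nplane_admissibleP => x y E1 E2.
- move: E1 E2; rewrite !mul1r !mul0r addr0 add0r => /eqP + /eqP.
  by rewrite !expf_eq0 /= => /eqP-> /eqP->.
- move: E1 E2; rewrite !mul1r !mul0r add0r => /eqP + /eqP.
  by rewrite [y ^+ 2 == _]expf_eq0 /= => + /eqP Ey;
    rewrite Ey expr0n mulr0 addr0 expf_eq0 => /eqP.
- by apply: rootfree_c0; rewrite E1 E2 !mulr0 addr0.
- by apply: (artin_schreier_anisotropic nb0); rewrite addrAC -[x ^+ 2]mul1r E1; ring2.
- move: E2 E1; rewrite !mul1r !mul0r add0r addr0 => /eqP.
  by rewrite expf_eq0 /= => /eqP ->; rewrite mulr0 => /eqP; rewrite expf_eq0 => /eqP.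
- move: E2 E1; rewrite !mul1r !mul0r add0r addr0 => /eqP.
  by rewrite expf_eq0 /= => /eqP ->; rewrite mul0r => /eqP; rewrite expf_eq0 => /eqP.
Qed.

Lemma rep_singular i :
  #|[set v in rep i | \det (sym_mx v) == 0]| = (#|F| + rep_k i * #|F| * #|F|.-1)%N.
Proof.
have q1 : (1 < #|F|)%N by apply: finNzRing_gt1.
have full : #|[set p : F * F | p.1 * (0 * p.1) ^+ 2 == 0]| = (#|F| * #|F|)%N.
  rewrite -cardsT -cardsX; apply: eq_card => p.
  by rewrite !inE mul0r expr0n mulr0 eqxx.
have line : #|[set p : F * F | p.1 * (1 * p.1) ^+ 2 == 0]| = #|F|.
  rewrite -[RHS]mul1n -(cards1 (0 : F)) -card_slice; apply: eq_card => p.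
  by rewrite !inE mul1r mulf_eq0 expf_eq0 /= orbb.
case6 i; rewrite /rep /rep_k /=.
- rewrite (singular_count (n1 := 2 * #|F|) full) => [|Y Y0].
    by case: #|F| q1 => // n _ /=; nia.
  rewrite -[X in (X * _)%N](_ : #|[set 0; Y]| = 2) -?card_slice; last by rewrite cards2 eq_sym Y0.
  apply: eq_card => p; rewrite !inE /= (_ : _ + _ = p.1 * Y * (p.1 + Y)); last by ring2.
  by rewrite !mulf_eq0 (negPf Y0) orbF addr_eq0 opp2.
- rewrite (singular_count (n1 := 0) full) => [|Y Y0].
    by case: #|F| q1 => // n _ /=; nia.
  apply: card_set_pred0 => p; apply/negP => /eqP E.
  (* With X = [p.1] the determinant is Y (X^2 + X Y + b0^2 Y^2). *)
  have [||_ /eqP] := @artin_schreier_anisotropic (b0 ^+ 2) p.1 Y; last by rewrite (negPf Y0).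
    by rewrite artin_schreier_sqr.
  by apply: (mulfI Y0); rewrite mulr0 -[RHS]E; ring2.
- rewrite (singular_count (n1 := 0) line) => [|Y Y0].
    by case: #|F| q1 => // n _ /=; nia.
  apply: card_set_pred0 => p; apply/negP => /eqP E.
  (* For X = x^2 and Y = y^2 the determinant is the square of the cubic form. *)
  have [x Ex] := sqr_surj p.1; have [y Ey] := sqr_surj Y.
  have [|_ y0] := rootfree_c0 (x := x) (y := y); last by rewrite -Ey y0 expr0n eqxx in Y0.
  by apply/eqP; rewrite -[_ == 0](expf_eq0 _ 2) -[X in _ == X]E -Ex -Ey; apply/eqP; ring2.
- rewrite (singular_count (n1 := #|F|) full) => [|Y Y0].
    by case: #|F| q1 => // n _ /=; nia.
  apply: (card_graph (h := fun=> 0)) => x y /=.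
  by rewrite !mul0r addr0 expr0n mulr0 add0r mulf_eq0 (negPf Y0) expf_eq0.
- rewrite (singular_count (n1 := #|F|) full) => [|Y Y0].
    by case: #|F| q1 => // n _ /=; nia.
  have [g gK Kg] := injF_bij sqr_inj.
  apply: (card_graph (h := fun x => g (x * Y))) => x y /=.
  rewrite (_ : _ + _ = Y * (x * Y + y ^+ 2)); last by ring.
  rewrite mulf_eq0 (negPf Y0) /= addr_eq0 opp2 -(inj_eq sqr_inj) /= Kg.
  by rewrite eq_sym.
- rewrite (singular_count (n1 := #|F|) line) => [|Y Y0].
    by case: #|F| q1 => // n _ /=; nia.
  have [g gK Kg] := injF_bij sqr_inj.
  apply: (card_graph (h := fun x => g (x ^+ 3 / Y))) => x y /=.
  rewrite -[RHS](inj_eq sqr_inj) /= Kg -[RHS](inj_eq (mulfI Y0)) [Y * (_ / _)]mulrC.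
  by rewrite divfK // -[RHS]subr_eq0; congr (_ == _); ring2.
Qed.

Lemma OD0_rep i U : U \in orbit 'P (K F) (rep i) ->
  OD0 U = [:: 0; 1; rep_k i * #|F|; #|F| ^ 2 + #|F| - rep_k i * #|F|]%N.
Proof.
move=> Ui; apply: OD0_singular.
- exact: admissible_orbit Ui (rep_admissible i).
- by case: (i) => [[|[|[|[|[|[|//]]]]]] ?].
- by case/mem_orbitK: Ui => A uA <-; rewrite singular_collineation // rep_singular.
Qed.

(** * Separating the orbits *)

Lemma orbit_nplane_last_row s s' a b c d a' b' c' d' A :
  (forall X Y t, congr_coord A (plane_pt s a b c d X Y t) \in nplane s' a' b' c' d') ->
  A 2 0 = 0 /\ A 2 1 = 0.
Proof.
move=> H; have sq0 X Y : A 2 0 ^+ 2 * X + A 2 1 ^+ 2 * Y = 0.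
  have /nplaneP[X' [Y' [t' /rowP/(_ 5)]]] := H X Y 0.
  rewrite [A in congr_coord A _]mx3_eta /plane_pt.
  by case: (s); case: (s'); rewrite congr_row6 !row6E mulr0 addr0.
have /eqP := sq0 1 0; have /eqP := sq0 0 1.
by rewrite !mulr0 !mulr1 add0r addr0 !expf_eq0 /= => /eqP-> /eqP->.
Qed.

Lemma mx3_last_row_neq0 A : A \in unitmx -> A 2 0 = 0 -> A 2 1 = 0 -> A 2 2 != 0.
Proof.
rewrite unitmxE unitfE [A in \det A]mx3_eta det_mx3 => dA A0 A1.
by apply: contraNneq dA => A2; rewrite A0 A1 A2 !(mulr0, addr0).
Qed.

(* The third row of A is (0, 0, u), so the nucleus vector (0,1,0,0,0,0) would   *)
(* be mapped to one with vanishing third column.                               *)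
Lemma nplane_type_inv a b c d a' b' c' d' :
  nplane false a' b' c' d' \notin orbit 'P (K F) (nplane true a b c d).
Proof.
apply/mem_orbitK => -[A uA E].
have H X Y t : congr_coord A (plane_pt true a b c d X Y t) \in nplane false a' b' c' d'.
  by rewrite -E; apply/memv_imgP; exists (plane_pt true a b c d X Y t); rewrite ?lfunE //;
    apply/nplaneP; exists X, Y, t.
have [A0 A1] := orbit_nplane_last_row H; have A2 := mx3_last_row_neq0 uA A0 A1.
have /nplaneP[X [Y [t]]] := H 0 0 1.
rewrite [A in congr_coord A _]mx3_eta /plane_pt congr_row6 A0 A1 => /rowP H'.
move: uA; rewrite unitmxE unitfE [A in \det A]mx3_eta det_mx3 A0 A1 => /eqP[].
(* The image of the nucleus vector has X = Y = 0, so its (0, 1) entry, the upper left 2 x 2 minor of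
   A, is 0. *)
move: (H' 0) (H' 3) (H' 1); rewrite !row6E !(mul0r, mulr0, add0r, addr0, mulr1) => <- <-.
rewrite !(mul0r, mulr0, add0r, addr0, mul1r) => E1.
rewrite (_ : _ + _ = A 2 2 * (A 0 0 * A 1 1 + A 0 1 * A 1 0)); last by ring.
by rewrite E1 mulr0.
Qed.

(* The third columns of the source plane span a line, those of the target do   *)
(* not.                                                                        *)
Lemma nplane_pencil_inv a b a' b' d' : d' != 0 ->
  nplane false a' b' 0 d' \notin orbit 'P (K F) (nplane false a b 0 0).
Proof.
move=> d0; apply/mem_orbitK => -[A uA E].
have H X Y t : congr_coord A (plane_pt false a b 0 0 X Y t) \in nplane false a' b' 0 d'.
  by rewrite -E; apply/memv_imgP; exists (plane_pt false a b 0 0 X Y t); rewrite ?lfunE //;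
    apply/nplaneP; exists X, Y, t.
have [A0 A1] := orbit_nplane_last_row H.
have sq0 X Y : A 1 0 ^+ 2 * X + A 1 1 ^+ 2 * Y = 0.
  have /nplaneP[X' [Y' [t']]] := H X Y 0.
  rewrite [A in congr_coord A _]mx3_eta /plane_pt congr_row6 A0 A1 => /rowP H'.
  (* For t = 0 the source has zero third column, so the (1, 2) entry d' Y' of the image is 0, Y'
     being its (1, 1) entry. *)
  apply: (mulfI d0); rewrite mulr0; move: (H' 3) (H' 4); rewrite !row6E.
  by rewrite !(mul0r, mulr0, add0r, addr0, mulr1) => -> <-.
have /eqP := sq0 1 0; have /eqP := sq0 0 1.
rewrite !mulr0 !mulr1 add0r addr0 !expf_eq0 /= => /eqP A11 /eqP A10.
move: uA; rewrite unitmxE unitfE [A in \det A]mx3_eta det_mx3 A0 A1 A11 A10 => /eqP[].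
by rewrite !(mul0r, mulr0, add0r, addr0).
Qed.

(** Equal distributions force equal [rep_k], which leaves only the index pairs 1, 5 and 3, 4. *)
Lemma rep_orbit_inj : injective (fun i => orbit 'P (K F) (rep i)).
Proof.
move=> i j /= E.
have ij : rep i \in orbit 'P (K F) (rep j) by rewrite -E orbit_refl.
have ji : rep j \in orbit 'P (K F) (rep i) by rewrite E orbit_refl.
have q0 : (0 < #|F|)%N by apply: ltnW; apply: finNzRing_gt1.
have := OD0_rep ij; rewrite (OD0_rep (orbit_refl _ _ _)) => -[/eqP + _].
rewrite eqn_pmul2r // => k; apply: val_inj.
move: ij ji k {E}; case6 i; case6 j; rewrite /rep /rep_k //= => H1 H2 _;
  by [case/negP: (nplane_type_inv 1 b0 0 1 0 1 1 0)
     |case/negP: (nplane_pencil_inv 1 b0 1 0 (oner_neq0 F))].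
Qed.

Lemma rep_ex U : admissible_plane U -> exists i, rep i \in orbit 'P (K F) U.
Proof.
move=> nsU; have [s [a [b [c [d H]]]]] := orbit_nplane_ex nsU.
have ns := admissible_orbit H nsU; move: H ns; case: s => H ns.
  have /or3P[] := nplane1_classification nb0 rootfree_c0 ns => /orbit_trans/(_ H) ?.
  - by exists 0.
  - by exists 1.
  - by exists 2.
have /or3P[] := nplane2_classification nb0 ns => /orbit_trans/(_ H) ?.
- by exists 3.
- by exists 4.
- by exists 5.
Qed.

End Representatives.
End EvenField.

(** * Counting the orbits *)

Theorem theorem4p7 (F : finFieldType) (q : nat) (card_F : #|F| = q)
    (q_even : ~~ odd q) :
  let planes : {set {vspace 'rV[F]_6}} :=
    [set U | [&& (\dim U == 3)%N,
                 [disjoint points U & veronese_surface F]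
               & (\dim (U :&: nucleus_plane F) == 1)%N]] in
  let orbits := [set orbit 'P (K F) U | U in planes] in
  let orbits_OD (d : seq nat) :=
    [set O in orbits | [forall U in O, OD0 U == d]] in
  [/\ #|orbits| = 6,
      #|orbits_OD [:: 0; 1; 0; q ^ 2 + q]| = 1,
      #|orbits_OD [:: 0; 1; 3 * q; q ^ 2 - 2 * q]| = 1,
      #|orbits_OD [:: 0; 1; q; q ^ 2]| = 2
    & #|orbits_OD [:: 0; 1; 2 * q; q ^ 2 - q]| = 2]%N.
Proof.
move=> planes orbits orbits_OD.
have two0 : 2%:R = 0 :> F.
  (* -1 = (-1) ^ q = 1 *)
  have := expf_card (-1 : F); rewrite card_F -signr_odd (negPf q_even) expr0 => E.
  by rewrite -[2%:R]/(1 + 1) {1}E addNr.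
have [b0 nb0] := nonsplit_quadratic_ex two0.
have [c0 nc0] := nonsplit_cubic_ex two0.
pose r := rep b0 c0; pose orb i := orbit 'P (K F) (r i).
have orb_inj : injective orb := rep_orbit_inj two0 nb0 nc0.
have Eorbits : orbits = orb @: [set: 'I_6].
  apply/setP=> O; apply/imsetP/imsetP => [[U]|[i _ ->]]; last first.
    by exists (r i); rewrite ?inE //; apply: rep_admissible.
  rewrite inE => /(rep_ex two0 nb0 nc0)[i /orbit_eqP Ei] ->.
  by exists i => //; rewrite /orb Ei.
have q1 : (1 < q)%N by rewrite -card_F finNzRing_gt1.
have ODcard k m : (k <= 3)%N -> #|[set i : 'I_6 | rep_k i == k]| = m ->
    #|orbits_OD [:: 0; 1; k * q; q ^ 2 + q - k * q]%N| = m.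
  move=> k3 <-; rewrite -(card_imset _ orb_inj); apply: eq_card => O.
  rewrite inE Eorbits; apply/andP/imsetP => [[/imsetP[i _ ->] /forall_inP H]|[i]].
    exists i => //; rewrite inE.
    have /H := orbit_refl 'P (K_group F) (r i).
    rewrite (OD0_rep two0 nb0 nc0 (orbit_refl _ _ _)) card_F => /eqP[/eqP + _].
    by rewrite eqn_pmul2r // ltnW.
  rewrite inE => /eqP ki ->; split; first by rewrite imset_f ?inE.
  by apply/forall_inP => U /(OD0_rep two0 nb0 nc0) ->; rewrite ki card_F.
have count k : #|[set i : 'I_6 | rep_k i == k]| = (\sum_(i < 6) (rep_k i == k))%N.
  by rewrite -sum1_card big_mkcond; apply: eq_bigr => i _; rewrite inE; case: eqP.
split.
- by rewrite Eorbits card_imset // cardsT card_ord.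
- by have := ODcard 0 1; rewrite mul0n subn0; apply=> //; rewrite count !big_ord_recl big_ord0.
- have -> : (q ^ 2 - 2 * q = q ^ 2 + q - 3 * q)%N by lia.
  by apply: ODcard => //; rewrite count !big_ord_recl big_ord0.
- have := ODcard 1 2; rewrite mul1n addnK; apply=> //; by rewrite count !big_ord_recl big_ord0.
- have -> : (q ^ 2 - q = q ^ 2 + q - 2 * q)%N by lia.
  by apply: ODcard => //; rewrite count !big_ord_recl big_ord0.
Qed.
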